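(* Let $\lambda\in P^+$ and $V\in\mathcal I_A^\lambda$. There exists a canonical map of $\mathfrak g\otimes A$-modules $\eta_V:\mathbf W_A^\lambda\mathbf R_A^\lambda V\to V$ such that $\eta:\mathbf W_A^\lambda\mathbf R_A^\lambda\Rightarrow\operatorname{id}_{\mathcal I_A^\lambda}$ is a natural transformation of functors, and $\mathbf R_A^\lambda$ is a right adjoint to $\mathbf W_A^\lambda$.
   Context: $\mathfrak g$ is a finite-dimensional simple Lie algebra over $\mathbb C$ of rank $n$, $I=\{1,\dots,n\}$, $\mathfrak h$ a Cartan subalgebra, $\alpha_i,\omega_i$ ($i\in I$) the simple roots and fundamental weights, $Q^+$ and $P^+$ the $\mathbb Z_{\ge 0}$-spans of the $\alpha_i$ and of the $\omega_i$; $\mu\le\lambda$ iff $\lambda-\mu\in Q^+$. $\mathbf U(-)$ denotes universal enveloping algebra. $A$ is a commutative associative unital $\mathbb C$-algebra (containing $\mathbb C=\mathbb C\cdot 1$); $\mathfrak g\otimes A$ is the Lie algebra with $[x\otimes a,y\otimes b]=[x,y]\otimes ab$, and $\mathfrak g$ is identified with $\mathfrak g\otimes 1$. A $\mathfrak g$-module is locally finite-dimensional if each element lies in a finite-dimensional $\mathfrak g$-submodule; then $V=\bigoplus_\mu V_\mu$ (weight spaces) and $\operatorname{wt}(V)=\{\mu: V_\mu\neq 0\}$. $V(\lambda)$ is the irreducible finite-dimensional $\mathfrak g$-module of highest weight $\lambda\in P^+$ with highest weight vector $v_\lambda$. $\mathcal I_A$ is the category of $\mathfrak g\otimes A$-modules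 that are locally finite-dimensional as $\mathfrak g$-modules, with all $\mathfrak g\otimes A$-module maps. For $\nu\in P^+$ and $V\in\mathcal I_A$, $V^\nu=V/\sum_{\mu\not\le\nu}\mathbf U(\mathfrak g\otimes A)V_\mu$, the maximal quotient with $\operatorname{wt}(V^\nu)\subset\nu-Q^+$; $\mathcal I_A^\nu$ is the full subcategory of $V$ with $V=V^\nu$. Global Weyl module: $P_A(V(\lambda))=\mathbf U(\mathfrak g\otimes A)\otimes_{\mathbf U(\mathfrak g)}V(\lambda)$, $W_A(\lambda)=P_A(V(\lambda))^\lambda$, and $w_\lambda$ is the image of $1\otimes v_\lambda$. $\operatorname{Ann}_{\mathfrak h\otimes A}(w_\lambda)=\{u\in\mathbf U(\mathfrak h\otimes A):uw_\lambda=0\}$ and $\mathbf A_\lambda=\mathbf U(\mathfrak h\otimes A)/\operatorname{Ann}_{\mathfrak h\otimes A}(w_\lambda)$, a commutative algebra. $W_A(\lambda)$ is a $(\mathfrak g\otimes A,\mathbf A_\lambda)$-bimodule, with right action $(uw_\lambda)(h\otimes a)=u(h\otimes a)w_\lambda$ for $u\in\mathbf U(\mathfrak g\otimes A)$, $h\in\mathfrak h$, $a\in A$. $\operatorname{mod}\mathbf A_\lambda$ is the category of left $\mathbf A_\lambda$-modules. The Weyl functor is $\mathbf W_A^\lambda:\operatorname{mod}\mathbf A_\lambda\to\mathcal I_A^\lambda$, $\mathbf W_A^\lambda M=W_A(\lambda)\otimes_{\mathbf A_\lambda}M$, $\mathbf W_A^\lambda f=1\otimes f$. For $V\in\mathcal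 I_A^\lambda$ the ideal $\operatorname{Ann}_{\mathfrak h\otimes A}(w_\lambda)$ kills $V_\lambda$, so $V_\lambda$ is a left $\mathbf A_\lambda$-module, denoted $\mathbf R_A^\lambda V$; $\mathbf R_A^\lambda\pi=\pi|_{V_\lambda}$ on morphisms. *)

(* Defs.v *)
From HB Require Import structures.
From mathcomp Require Import all_boot all_order all_algebra.
From mathcomp Require Import boolp.

Set Implicit Arguments.
Unset Strict Implicit.
Unset Printing Implicit Defensive.

Import GRing.Theory.
Local Open Scope ring_scope.
Local Open Scope quotient_scope.

Record submodule (R : pzRingType) (V : lmodType R) := Submodule {
  submod_mem :> {pred V};
  submod_memP : GRing.submod_closed submod_mem }.

Section QuotientModule.
Variables (R : pzRingType) (V : lmodType R) (N : submodule V).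

Lemma submod_zmod : GRing.zmod_closed (submod_mem N).
Proof.
have [h0 hl] := submod_memP N; split=> // x y xN yN.
by rewrite addrC -scaleN1r; apply: hl.
Qed.
HB.instance Definition _ := GRing.isZmodClosed.Build V (submod_mem N) submod_zmod.

Lemma submodZ (a : R) (x : V) : x \in submod_mem N -> a *: x \in submod_mem N.
Proof.
by have [h0 hl] := submod_memP N => xN; rewrite -[a *: x]addr0; apply: hl.
Qed.

Definition quotmod : Type := Quotient.quot (submod_mem N).
HB.instance Definition _ := GRing.Zmodule.on quotmod.

Definition qproj (x : V) : quotmod := \pi_(Quotient.quot (submod_mem N)) x.

Lemma qprojP x y : qproj x = qproj y <-> x - y \in submod_mem N.
Proof. by rewrite Quotient.idealrBE; split=> [/eqP|/eqP]. Qed.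
Lemma qprojK (x : quotmod) : qproj (repr x) = x. Proof. exact: reprK. Qed.
Lemma qprojD : {morph qproj : x y / x + y}.
Proof. by move=> x y; rewrite /qproj raddfD. Qed.

Definition qscale (a : R) (x : quotmod) : quotmod := qproj (a *: repr x).
Lemma qscaleE a x : qscale a (qproj x) = qproj (a *: x).
Proof. by apply/qprojP; rewrite -scalerBr; apply/submodZ/qprojP; rewrite qprojK. Qed.

Fact qscalerA a b v : qscale a (qscale b v) = qscale (a * b) v.
Proof. by rewrite -(qprojK v) !qscaleE scalerA. Qed.
Fact qscale1r : left_id 1 qscale.
Proof. by move=> v; rewrite -(qprojK v) qscaleE scale1r. Qed.
Fact qscalerDr : right_distributive qscale +%R.
Proof.
by move=> a u v; rewrite -(qprojK u) -(qprojK v) -qprojD !qscaleE scalerDr qprojD.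
Qed.
Fact qscalerDl v : {morph qscale^~ v : a b / a + b}.
Proof. by move=> a b; rewrite -(qprojK v) !qscaleE scalerDl qprojD. Qed.
HB.instance Definition _ := GRing.Zmodule_isLmodule.Build R quotmod
  qscalerA qscale1r qscalerDr qscalerDl.

Fact qproj_linear : linear qproj.
Proof. by move=> a x y; rewrite qprojD -[qproj (a *: x)]qscaleE. Qed.
HB.instance Definition _ := GRing.isLinear.Build R V quotmod *:%R qproj qproj_linear.
End QuotientModule.

Record ideal (R : pzRingType) := Ideal {
  ideal_mem :> {pred R};
  ideal_zmod : GRing.zmod_closed ideal_mem;
  idealMl : forall a x, x \in ideal_mem -> a * x \in ideal_mem;
  idealMr : forall a x, x \in ideal_mem -> x * a \in ideal_mem }.

Section QuotientRing.
Variables (R : pzRingType) (J : ideal R).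
HB.instance Definition _ := GRing.isZmodClosed.Build R (ideal_mem J) (ideal_zmod J).

Definition quotring : Type := Quotient.quot (ideal_mem J).
HB.instance Definition _ := GRing.Zmodule.on quotring.

Definition rproj (x : R) : quotring := \pi_(Quotient.quot (ideal_mem J)) x.
Lemma rprojP x y : rproj x = rproj y <-> x - y \in ideal_mem J.
Proof. by rewrite Quotient.idealrBE; split=> [/eqP|/eqP]. Qed.
Lemma rprojK (x : quotring) : rproj (repr x) = x. Proof. exact: reprK. Qed.
Lemma rprojD : {morph rproj : x y / x + y}.
Proof. by move=> x y; rewrite /rproj raddfD. Qed.

Definition qmul (x y : quotring) : quotring := rproj (repr x * repr y).
Lemma qmulE x y : qmul (rproj x) (rproj y) = rproj (x * y).
Proof.
apply/rprojP; set x' := repr _; set y' := repr _.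
have hx : x' - x \in ideal_mem J by apply/rprojP; rewrite rprojK.
have hy : y' - y \in ideal_mem J by apply/rprojP; rewrite rprojK.
have -> : x' * y' - x * y = (x' - x) * y' + x * (y' - y).
  by rewrite mulrBl mulrBr addrA subrK.
by apply: rpredD; [apply: idealMr | apply: idealMl].
Qed.
Fact qmulA : associative qmul.
Proof.
by move=> x y z; rewrite -(rprojK x) -(rprojK y) -(rprojK z) !qmulE mulrA.
Qed.
Fact qmul1r : left_id (rproj 1) qmul.
Proof. by move=> x; rewrite -(rprojK x) qmulE mul1r. Qed.
Fact qmulr1 : right_id (rproj 1) qmul.
Proof. by move=> x; rewrite -(rprojK x) qmulE mulr1. Qed.
Fact qmulDl : left_distributive qmul +%R.
Proof.
move=> x y z; rewrite -(rprojK x) -(rprojK y) -(rprojK z).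
by rewrite -rprojD !qmulE mulrDl rprojD.
Qed.
Fact qmulDr : right_distributive qmul +%R.
Proof.
move=> x y z; rewrite -(rprojK x) -(rprojK y) -(rprojK z).
by rewrite -rprojD !qmulE mulrDr rprojD.
Qed.
HB.instance Definition _ := GRing.Zmodule_isPzRing.Build quotring
  qmulA qmul1r qmulr1 qmulDl qmulDr.

Lemma rprojM x y : rproj (x * y) = rproj x * rproj y.
Proof. exact: esym (qmulE x y). Qed.
Lemma rproj1 : rproj 1 = 1. Proof. by []. Qed.
End QuotientRing.

Definition restr_scalars (R S : pzRingType) (f : {rmorphism R -> S})
  (V : lmodType S) : Type := V.

Section Restriction.
Variables (R S : pzRingType) (f : {rmorphism R -> S}) (V : lmodType S).
Local Notation rV := (restr_scalars f V).
HB.instance Definition _ := GRing.Zmodule.copy rV V.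
Definition rscale (a : R) (v : rV) : rV := f a *: (v : V).
Fact rscalerA a b v : rscale a (rscale b v) = rscale (a * b) v.
Proof. by rewrite /rscale scalerA rmorphM. Qed.
Fact rscale1r : left_id 1 rscale.
Proof. by move=> v; rewrite /rscale rmorph1 scale1r. Qed.
Fact rscalerDr : right_distributive rscale +%R.
Proof. by move=> a u v; rewrite /rscale scalerDr. Qed.
Fact rscalerDl v : {morph rscale^~ v : a b / a + b}.
Proof. by move=> a b; rewrite /rscale rmorphD scalerDl. Qed.
HB.instance Definition _ := GRing.Zmodule_isLmodule.Build R rV
  rscalerA rscale1r rscalerDr rscalerDl.
End Restriction.

Record bimodule (S R : pzRingType) := Bimodule {
  bimod_sort :> lmodType S;
  ract : bimod_sort -> R -> bimod_sort;
  ractDl : forall a, {morph ract^~ a : x y / x + y};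
  ractDr : forall x, {morph ract x : a b / a + b};
  ract1 : forall x, ract x 1 = x;
  ractA : forall x a b, ract (ract x a) b = ract x (a * b);
  ractZ : forall s x a, ract (s *: x) a = s *: ract x a }.

(* The tensor product M (x)_R N: formal sums of symbols m (x) n modulo the     *)
(* congruence generated by the abelian group axioms, biadditivity and          *)
(* R-balancedness.                                                             *)
Section TensorProduct.
Variables (S R : pzRingType) (M : bimodule S R) (N : lmodType R).

Inductive tterm : Type :=
| TPure of M & N
| TZero
| TAdd of tterm & tterm
| TOpp of tterm.

Inductive tcong : tterm -> tterm -> Prop :=
| tc_refl x : tcong x x
| tc_sym x y : tcong x y -> tcong y x
| tc_trans x y z : tcong x y -> tcong y z -> tcong x z
| tc_add x x' y y' : tcong x x' -> tcong y y' -> tcong (TAdd x y) (TAdd x' y')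
| tc_opp x x' : tcong x x' -> tcong (TOpp x) (TOpp x')
| tc_addA x y z : tcong (TAdd x (TAdd y z)) (TAdd (TAdd x y) z)
| tc_addC x y : tcong (TAdd x y) (TAdd y x)
| tc_add0 x : tcong (TAdd TZero x) x
| tc_addN x : tcong (TAdd (TOpp x) x) TZero
| tc_pureDl m m' n : tcong (TPure (m + m') n) (TAdd (TPure m n) (TPure m' n))
| tc_pureDr m n n' : tcong (TPure m (n + n')) (TAdd (TPure m n) (TPure m n'))
| tc_bal m a n : tcong (TPure (ract m a) n) (TPure m (a *: n)).

HB.instance Definition _ := gen_eqMixin tterm.
HB.instance Definition _ := gen_choiceMixin tterm.

Definition tcongb (x y : tterm) : bool := `[< tcong x y >].
Fact tcong_equiv : equiv_class_of tcongb.
Proof.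
split=> [x|x y|y x z]; first by apply/asboolP/tc_refl.
- by apply/asboolP/asboolP; apply: tc_sym.
- by move=> /asboolP xy /asboolP yz; apply/asboolP; apply: tc_trans xy yz.
Qed.
Canonical tcong_equivRel := EquivRelPack tcong_equiv.
Canonical tcong_encModRel := defaultEncModRel tcongb.

Definition tensor : Type := {eq_quot tcongb}.
HB.instance Definition _ := Choice.on tensor.
Definition tcl (x : tterm) : tensor := \pi_{eq_quot tcongb} x.
Lemma tclP x y : tcl x = tcl y <-> tcong x y.
Proof.
rewrite /tcl; split=> [/eqP|h]; first by rewrite piE => /asboolP.
by apply/eqP; rewrite piE; apply/asboolP.
Qed.
Lemma tclK (x : tensor) : tcl (repr x) = x. Proof. exact: reprK. Qed.
Lemma trepr x : tcong (repr (tcl x)) x. Proof. by apply/tclP; rewrite tclK. Qed.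

Definition tadd (x y : tensor) : tensor := tcl (TAdd (repr x) (repr y)).
Definition topp (x : tensor) : tensor := tcl (TOpp (repr x)).
Lemma taddE x y : tadd (tcl x) (tcl y) = tcl (TAdd x y).
Proof. by apply/tclP/tc_add; apply: trepr. Qed.
Lemma toppE x : topp (tcl x) = tcl (TOpp x).
Proof. by apply/tclP/tc_opp; apply: trepr. Qed.
Fact taddA : associative tadd.
Proof.
move=> x y z; rewrite -(tclK x) -(tclK y) -(tclK z) !taddE.
by apply/tclP/tc_addA.
Qed.
Fact taddC : commutative tadd.
Proof. by move=> x y; rewrite -(tclK x) -(tclK y) !taddE; apply/tclP/tc_addC. Qed.
Fact tadd0 : left_id (tcl TZero) tadd.
Proof. by move=> x; rewrite -(tclK x) taddE; apply/tclP/tc_add0. Qed.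
Fact taddN : left_inverse (tcl TZero) topp tadd.
Proof. by move=> x; rewrite -(tclK x) toppE taddE; apply/tclP/tc_addN. Qed.
HB.instance Definition _ := GRing.isZmodule.Build tensor taddA taddC tadd0 taddN.

Lemma tclD x y : tcl x + tcl y = tcl (TAdd x y). Proof. exact: taddE. Qed.
Lemma tclN x : - tcl x = tcl (TOpp x). Proof. exact: toppE. Qed.

Definition pure (m : M) (n : N) : tensor := tcl (TPure m n).
Lemma pureDl m m' n : pure (m + m') n = pure m n + pure m' n.
Proof. by rewrite /pure tclD; apply/tclP/tc_pureDl. Qed.
Lemma pureDr m n n' : pure m (n + n') = pure m n + pure m n'.
Proof. by rewrite /pure tclD; apply/tclP/tc_pureDr. Qed.
Lemma pure_bal m a n : pure (ract m a) n = pure m (a *: n).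
Proof. by apply/tclP/tc_bal. Qed.
Lemma pure0l n : pure 0 n = 0.
Proof. by apply: (addrI (pure 0 n)); rewrite -pureDl !addr0. Qed.
Lemma pureNl m n : pure (- m) n = - pure m n.
Proof. by apply: (addrI (pure m n)); rewrite -pureDl !subrr pure0l. Qed.

Lemma tensor_ind (P : tensor -> Prop) :
  (forall m n, P (pure m n)) -> (forall x y, P x -> P y -> P (x + y)) ->
  forall x, P x.
Proof.
move=> hp hD x; rewrite -(tclK x).
suff: P (tcl (repr x)) /\ P (- tcl (repr x)) by case.
elim: (repr x) => [m n||y [hy hy'] z [hz hz']|y [hy hy']].
- by split; [exact: hp | rewrite -pureNl; exact: hp].
- have -> : tcl TZero = 0 by [].
  by split; rewrite ?oppr0 -(pure0l 0); exact: hp.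
- have -> : tcl (TAdd y z) = tcl y + tcl z by rewrite tclD.
  by split; rewrite ?opprD; apply: hD.
- have -> : tcl (TOpp y) = - tcl y by rewrite tclN.
  by rewrite opprK.
Qed.

Section Lift.
Variables (Z : zmodType) (f : M -> N -> Z).
Hypotheses (fDl : forall n, {morph f^~ n : x y / x + y})
           (fDr : forall m, {morph f m : x y / x + y})
           (fbal : forall m a n, f (ract m a) n = f m (a *: n)).
Fixpoint teval (x : tterm) : Z := match x with
  | TPure m n => f m n
  | TZero => 0
  | TAdd x y => teval x + teval y
  | TOpp x => - teval x
  end.
Lemma teval_cong x y : tcong x y -> teval x = teval y.
Proof.
elim=> {x y} /=.
- by [].
- by move=> x y _ ->.
- by move=> x y z _ -> _ ->.
- by move=> x x' y y' _ -> _ ->.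
- by move=> x x' _ ->.
- by move=> x y z; rewrite addrA.
- by move=> x y; rewrite addrC.
- by move=> x; rewrite add0r.
- by move=> x; rewrite addNr.
- by move=> m m' n; rewrite fDl.
- by move=> m n n'; rewrite fDr.
- by move=> m a n; rewrite fbal.
Qed.
End Lift.

Definition tlift (Z : zmodType) (f : M -> N -> Z) (x : tensor) : Z :=
  teval f (repr x).

Section LiftTheory.
Variables (Z : zmodType) (f : M -> N -> Z).
Hypotheses (fDl : forall n, {morph f^~ n : x y / x + y})
           (fDr : forall m, {morph f m : x y / x + y})
           (fbal : forall m a n, f (ract m a) n = f m (a *: n)).
Lemma tlift_cl x : tlift f (tcl x) = teval f x.
Proof. exact: (teval_cong fDl fDr fbal (trepr x)). Qed.
Lemma tlift_pure m n : tlift f (pure m n) = f m n.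
Proof. by rewrite tlift_cl. Qed.
Lemma tliftD : {morph tlift f : x y / x + y}.
Proof.
move=> x y; rewrite -{1}(tclK x) -{1}(tclK y).
by rewrite tclD tlift_cl /= -!tlift_cl !tclK.
Qed.
End LiftTheory.

Section Scale.
Variable s : S.
Let f (m : M) (n : N) := pure (s *: m) n.
Definition tscale : tensor -> tensor := tlift f.
Fact tscale_Dl n : {morph f^~ n : x y / x + y}.
Proof. by move=> x y; rewrite /f scalerDr pureDl. Qed.
Fact tscale_Dr m : {morph f m : x y / x + y}.
Proof. by move=> x y; rewrite /f pureDr. Qed.
Fact tscale_bal m a n : f (ract m a) n = f m (a *: n).
Proof. by rewrite /f -ractZ pure_bal. Qed.
Lemma tscale_pure m n : tscale (pure m n) = pure (s *: m) n.
Proof. exact: tlift_pure tscale_Dl tscale_Dr tscale_bal _ _. Qed.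
Lemma tscaleD : {morph tscale : x y / x + y}.
Proof. exact: tliftD tscale_Dl tscale_Dr tscale_bal. Qed.
End Scale.

Fact tscalerA a b v : tscale a (tscale b v) = tscale (a * b) v.
Proof.
elim/tensor_ind: v => [m n|x y hx hy]; first by rewrite !tscale_pure scalerA.
by rewrite !tscaleD hx hy.
Qed.
Fact tscale1r : left_id 1 tscale.
Proof.
by elim/tensor_ind=> [m n|x y hx hy]; rewrite ?tscale_pure ?scale1r // tscaleD hx hy.
Qed.
Fact tscalerDr : right_distributive tscale +%R.
Proof. by move=> a u v; rewrite tscaleD. Qed.
Fact tscalerDl v : {morph tscale^~ v : a b / a + b}.
Proof.
move=> a b; elim/tensor_ind: v => [m n|x y hx hy].
  by rewrite !tscale_pure scalerDl pureDl.
by rewrite !tscaleD hx hy addrACA.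
Qed.
HB.instance Definition _ := GRing.Zmodule_isLmodule.Build S tensor
  tscalerA tscale1r tscalerDr tscalerDl.
Lemma pureZl s m n : pure (s *: m) n = s *: pure m n.
Proof. by rewrite -tscale_pure. Qed.
End TensorProduct.

Section TensorMap.
Variables (S R : pzRingType) (M : bimodule S R) (N N' : lmodType R).
Variable (f : {linear N -> N'}).
Let F (m : M) (n : N) : tensor M N' := pure m (f n).
Definition tensor_map : tensor M N -> tensor M N' := tlift F.
Fact tmapDl n : {morph F^~ n : x y / x + y}.
Proof. by move=> x y; rewrite /F pureDl. Qed.
Fact tmapDr m : {morph F m : x y / x + y}.
Proof. by move=> x y; rewrite /F linearD pureDr. Qed.
Fact tmap_bal m a n : F (ract m a) n = F m (a *: n).
Proof. by rewrite /F linearZ pure_bal. Qed.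
Lemma tensor_map_pure (m : M) n : tensor_map (pure m n) = pure m (f n).
Proof. exact: tlift_pure tmapDl tmapDr tmap_bal _ _. Qed.
Fact tensor_map_linear : linear tensor_map.
Proof.
have D : {morph tensor_map : x y / x + y} := tliftD tmapDl tmapDr tmap_bal.
move=> a u v; rewrite D; congr (_ + _).
elim/tensor_ind: u => [m n|x y hx hy]; first by rewrite -pureZl !tensor_map_pure pureZl.
by rewrite scalerDr !D hx hy scalerDr.
Qed.
HB.instance Definition _ := GRing.isLinear.Build S (tensor M N) (tensor M N') *:%R
  tensor_map tensor_map_linear.
End TensorMap.

Section ScalarBimodule.
Variables (K : comNzRingType) (V : lmodType K).
Fact sbimDl a : {morph (fun v : V => a *: v) : x y / x + y}.
Proof. by move=> x y; rewrite scalerDr. Qed.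
Fact sbimDr (v : V) : {morph (fun a => a *: v) : x y / x + y}.
Proof. by move=> x y; rewrite scalerDl. Qed.
Fact sbimA (x : V) a b : b *: (a *: x) = (a * b) *: x.
Proof. by rewrite scalerA mulrC. Qed.
Fact sbimZ (s : K) (x : V) a : a *: (s *: x) = s *: (a *: x).
Proof. by rewrite !scalerA mulrC. Qed.
Definition scalar_bimod : bimodule K K :=
  @Bimodule K K V (fun v a => a *: v) sbimDl sbimDr (@scale1r K V) sbimA sbimZ.
End ScalarBimodule.

Section RegularBimodule.
Variables (R S : pzRingType) (f : {rmorphism R -> S}).
Fact rbimDl a : {morph (fun v : S^o => (v * f a : S^o)) : x y / x + y}.
Proof. by move=> x y; rewrite mulrDl. Qed.
Fact rbimDr (v : S^o) : {morph (fun a => (v * f a : S^o)) : x y / x + y}.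
Proof. by move=> x y; rewrite rmorphD mulrDr. Qed.
Fact rbim1 (v : S^o) : v * f 1 = v. Proof. by rewrite rmorph1 mulr1. Qed.
Fact rbimA (x : S^o) a b : x * f a * f b = x * f (a * b).
Proof. by rewrite rmorphM mulrA. Qed.
Fact rbimZ (s : S) (x : S^o) a : (s *: x) * f a = s *: (x * f a : S^o).
Proof. by rewrite -[LHS]mulrA. Qed.
Definition regular_bimod : bimodule S R :=
  @Bimodule S R S^o (fun v a => v * f a) rbimDl rbimDr rbim1 rbimA rbimZ.
End RegularBimodule.

HB.mixin Record Lmodule_isLie (K : comNzRingType) L of GRing.Lmodule K L := {
  lieb : L -> L -> L;
  lieb_linearl : forall y, linear (lieb^~ y);
  lieb_linearr : forall x, linear (lieb x);
  liebxx : forall x, lieb x x = 0;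
  lieb_jacobi : forall x y z,
    lieb x (lieb y z) + lieb y (lieb z x) + lieb z (lieb x y) = 0 }.
#[short(type="lieAlgType")]
HB.structure Definition LieAlgebra (K : comNzRingType) :=
  {L of GRing.Lmodule K L & Lmodule_isLie K L}.
#[short(type="lieVectType")]
HB.structure Definition LieVector (K : comNzRingType) :=
  {L of Vector K L & LieAlgebra K L}.

Section LieTheory.
Variables (K : comNzRingType) (L : lieAlgType K).
Implicit Types x y z : L.
Lemma liebDl x y z : lieb (x + y) z = lieb x z + lieb y z.
Proof. by have := lieb_linearl z 1 x y; rewrite !scale1r. Qed.
Lemma liebDr x y z : lieb x (y + z) = lieb x y + lieb x z.
Proof. by have := lieb_linearr x 1 y z; rewrite !scale1r. Qed.
Lemma lieb0l x : lieb 0 x = 0.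
Proof. by apply: (addrI (lieb 0 x)); rewrite -liebDl !addr0. Qed.
Lemma lieb0r x : lieb x 0 = 0.
Proof. by apply: (addrI (lieb x 0)); rewrite -liebDr !addr0. Qed.
Lemma liebZl a x y : lieb (a *: x) y = a *: lieb x y.
Proof. by have := lieb_linearl y a x 0; rewrite !addr0 lieb0l addr0. Qed.
Lemma liebZr a x y : lieb x (a *: y) = a *: lieb x y.
Proof. by have := lieb_linearr x a y 0; rewrite !addr0 lieb0r addr0. Qed.
Lemma liebC x y : lieb x y = - lieb y x.
Proof.
have := liebxx (x + y); rewrite liebDl !liebDr !liebxx add0r addr0.
by move/eqP; rewrite addr_eq0 => /eqP.
Qed.
End LieTheory.

Record lieHom (K : comNzRingType) (L L' : lieAlgType K) := LieHom {
  lie_fun :> {linear L -> L'};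
  lie_funP : forall x y, lie_fun (lieb x y) = lieb (lie_fun x) (lie_fun y) }.

Section CurrentAlgebra.
Variables (K : comNzRingType) (g : lieAlgType K) (A : comAlgType K).
Definition current : Type := tensor (scalar_bimod g) A.
HB.instance Definition _ := GRing.Lmodule.on current.
Definition cur (x : g) (a : A) : current := @pure K K (scalar_bimod g) A x a.

Lemma cur_ind (P : current -> Prop) :
  (forall x a, P (cur x a)) -> (forall x y, P x -> P y -> P (x + y)) ->
  forall x, P x.
Proof. exact: (@tensor_ind K K (scalar_bimod g) A). Qed.
Lemma curDl x y a : cur (x + y) a = cur x a + cur y a.
Proof. exact: (@pureDl K K (scalar_bimod g) A). Qed.
Lemma curDr x a b : cur x (a + b) = cur x a + cur x b.
Proof. exact: (@pureDr K K (scalar_bimod g) A). Qed.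
Lemma curZl c x a : cur (c *: x) a = c *: cur x a.
Proof. exact: (@pureZl K K (scalar_bimod g) A). Qed.
Lemma curZr c x a : cur x (c *: a) = c *: cur x a.
Proof. by rewrite -curZl; exact: esym (@pure_bal K K (scalar_bimod g) A x c a). Qed.
Lemma curNl x a : cur (- x) a = - cur x a.
Proof. exact: (@pureNl K K (scalar_bimod g) A). Qed.

Section Bracket1.
Variables (x : g) (a : A).
Let f (y : scalar_bimod g) (b : A) : current := cur (lieb x y) (a * b).
Definition cbr1 : current -> current := tlift f.
Fact cbr1_Dl b : {morph f^~ b : y z / y + z}.
Proof. by move=> y z; rewrite /f liebDr curDl. Qed.
Fact cbr1_Dr y : {morph f y : b c / b + c}.
Proof. by move=> b c; rewrite /f mulrDr curDr. Qed.
Fact cbr1_bal y (k : K) b : f (ract y k) b = f y (k *: b).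
Proof. by rewrite /f /= liebZr -scalerAr curZl curZr. Qed.
Lemma cbr1_cur y b : cbr1 (cur y b) = cur (lieb x y) (a * b).
Proof. exact: tlift_pure cbr1_Dl cbr1_Dr cbr1_bal _ _. Qed.
Lemma cbr1D : {morph cbr1 : y z / y + z}.
Proof. exact: tliftD cbr1_Dl cbr1_Dr cbr1_bal. Qed.
End Bracket1.

Section Bracket2.
Variable v : current.
Let f (x : scalar_bimod g) (a : A) : current := cbr1 x a v.
Definition cbr2 : current -> current := tlift f.
Fact cbr2_Dl b : {morph f^~ b : y z / y + z}.
Proof.
rewrite /f => y z; elim/cur_ind: v => [w c|w1 w2 h1 h2].
  by rewrite !cbr1_cur liebDl curDl.
by rewrite !cbr1D h1 h2 addrACA.
Qed.
Fact cbr2_Dr y : {morph f y : b c / b + c}.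
Proof.
rewrite /f => b c; elim/cur_ind: v => [w d|w1 w2 h1 h2].
  by rewrite !cbr1_cur mulrDl curDr.
by rewrite !cbr1D h1 h2 addrACA.
Qed.
Fact cbr2_bal y (k : K) b : f (ract y k) b = f y (k *: b).
Proof.
rewrite /f; elim/cur_ind: v => [w d|w1 w2 h1 h2].
  by rewrite !cbr1_cur /= liebZl -scalerAl curZl curZr.
by rewrite !cbr1D h1 h2.
Qed.
Lemma cbr2_cur x a : cbr2 (cur x a) = cbr1 x a v.
Proof. exact: tlift_pure cbr2_Dl cbr2_Dr cbr2_bal _ _. Qed.
Lemma cbr2D : {morph cbr2 : y z / y + z}.
Proof. exact: tliftD cbr2_Dl cbr2_Dr cbr2_bal. Qed.
End Bracket2.

Definition cbr (u v : current) : current := cbr2 v u.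
Lemma cbrE x a y b : cbr (cur x a) (cur y b) = cur (lieb x y) (a * b).
Proof. by rewrite /cbr cbr2_cur cbr1_cur. Qed.
Lemma cbrDl u v w : cbr (u + v) w = cbr u w + cbr v w.
Proof. exact: cbr2D. Qed.
Lemma cbrDr u v w : cbr u (v + w) = cbr u v + cbr u w.
Proof.
elim/cur_ind: u => [x a|x y hx hy]; first by rewrite /cbr !cbr2_cur cbr1D.
by rewrite !cbrDl hx hy addrACA.
Qed.
Lemma cbrZl c u v : cbr (c *: u) v = c *: cbr u v.
Proof.
elim/cur_ind: u => [x a|x y hx hy]; last by rewrite scalerDr !cbrDl hx hy scalerDr.
elim/cur_ind: v => [y b|y z hy hz]; last by rewrite !cbrDr hy hz scalerDr.
by rewrite -curZl !cbrE liebZl curZl.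
Qed.
Lemma cbrC u v : cbr u v = - cbr v u.
Proof.
elim/cur_ind: u => [x a|x y hx hy]; last by rewrite cbrDl cbrDr hx hy opprD.
elim/cur_ind: v => [y b|y z hy hz]; last by rewrite cbrDl cbrDr hy hz opprD.
by rewrite !cbrE liebC curNl mulrC.
Qed.
Lemma cbrZr c u v : cbr u (c *: v) = c *: cbr u v.
Proof. by rewrite cbrC cbrZl -scalerN -cbrC. Qed.

Fact cbr_linearl v : linear (cbr^~ v).
Proof. by move=> c x y; rewrite cbrDl cbrZl. Qed.
Fact cbr_linearr u : linear (cbr u).
Proof. by move=> c x y; rewrite cbrDr cbrZr. Qed.
Fact cbrxx u : cbr u u = 0.
Proof.
elim/cur_ind: u => [x a|x y hx hy].
  by rewrite cbrE liebxx; exact: (@pure0l K K (scalar_bimod g) A).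
by rewrite cbrDl !cbrDr hx hy add0r addr0 cbrC addNr.
Qed.
Fact cbr_jacobi u v w : cbr u (cbr v w) + cbr v (cbr w u) + cbr w (cbr u v) = 0.
Proof.
have sw (a b c d e f : current) :
  a + b + (c + d) + (e + f) = (a + c + e) + (b + d + f).
  by rewrite (addrACA a b c d) (addrACA (a + c)).
elim/cur_ind: u => [x a|x y hx hy];
  last by rewrite !(cbrDl, cbrDr) sw hx hy addr0.
elim/cur_ind: v => [y b|y z hy hz];
  last by rewrite !(cbrDl, cbrDr) sw hy hz addr0.
elim/cur_ind: w => [z c|z z' hz hz'];
  last by rewrite !(cbrDl, cbrDr) sw hz hz' addr0.
rewrite !cbrE.
have -> : b * (c * a) = a * (b * c) by rewrite mulrA mulrC.
have -> : c * (a * b) = a * (b * c) by rewrite mulrC mulrA.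
by rewrite -!curDl lieb_jacobi; exact: (@pure0l K K (scalar_bimod g) A).
Qed.
HB.instance Definition _ := Lmodule_isLie.Build K current
  cbr_linearl cbr_linearr cbrxx cbr_jacobi.
Lemma lieb_cur x a y b : lieb (cur x a) (cur y b) = cur (lieb x y) (a * b).
Proof. exact: cbrE. Qed.

Definition cur1 (x : g) : current := cur x 1.
Fact cur1_linear : linear cur1.
Proof. by move=> c x y; rewrite /cur1 curDl curZl. Qed.
HB.instance Definition _ := GRing.isLinear.Build K g current *:%R cur1 cur1_linear.
Fact cur1_lie x y : cur1 (lieb x y) = lieb (cur1 x) (cur1 y).
Proof. by rewrite /cur1 lieb_cur mulr1. Qed.
Definition cur1_hom : lieHom g current := LieHom cur1_lie.
End CurrentAlgebra.

Section CurrentMap.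
Variables (K : comNzRingType) (g g' : lieAlgType K) (f : lieHom g g').
Variable (A : comAlgType K).
Let F (x : scalar_bimod g) (a : A) : current g' A := cur (f x) a.
Definition current_map : current g A -> current g' A := tlift F.
Fact cmapDl a : {morph F^~ a : x y / x + y}.
Proof. by move=> x y; rewrite /F linearD curDl. Qed.
Fact cmapDr x : {morph F x : a b / a + b}.
Proof. by move=> a b; rewrite /F curDr. Qed.
Fact cmap_bal x (k : K) a : F (ract x k) a = F x (k *: a).
Proof. by rewrite /F /= linearZ curZl curZr. Qed.
Lemma current_map_cur x a : current_map (cur x a) = cur (f x) a.
Proof. exact: tlift_pure cmapDl cmapDr cmap_bal _ _. Qed.
Lemma current_mapD : {morph current_map : x y / x + y}.
Proof. exact: tliftD cmapDl cmapDr cmap_bal. Qed.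
Fact current_map_linear : linear current_map.
Proof.
move=> c u v; rewrite current_mapD; congr (_ + _).
elim/cur_ind: u => [x a|x y hx hy].
  by rewrite -curZl !current_map_cur linearZ curZl.
by rewrite scalerDr !current_mapD hx hy scalerDr.
Qed.
HB.instance Definition _ :=
  GRing.isLinear.Build K (current g A) (current g' A) *:%R current_map
    current_map_linear.
Fact current_map_lie u v :
  current_map (lieb u v) = lieb (current_map u) (current_map v).
Proof.
elim/cur_ind: u => [x a|x y hx hy];
  last by rewrite liebDl !current_mapD hx hy liebDl.
elim/cur_ind: v => [y b|y z hy hz];
  last by rewrite liebDr !current_mapD hy hz liebDr.
by rewrite lieb_cur !current_map_cur lie_funP lieb_cur.
Qed.
Definition current_hom : lieHom (current g A) (current g' A) :=
  LieHom current_map_lie.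
End CurrentMap.

(* The universal enveloping algebra U(L): the associative unital K-algebra     *)
(* generated by L, subject to K-linearity of the generators and to             *)
(* x y - y x = [x, y].                                                         *)
Section Enveloping.
Variables (K : comNzRingType) (L : lieAlgType K).

Inductive uterm : Type :=
| UGen of L
| UZero
| UOne
| UAdd of uterm & uterm
| UOpp of uterm
| UMul of uterm & uterm
| UScale of K & uterm.

Inductive ucong : uterm -> uterm -> Prop :=
| uc_refl x : ucong x x
| uc_sym x y : ucong x y -> ucong y x
| uc_trans x y z : ucong x y -> ucong y z -> ucong x z
| uc_add x x' y y' : ucong x x' -> ucong y y' -> ucong (UAdd x y) (UAdd x' y')
| uc_opp x x' : ucong x x' -> ucong (UOpp x) (UOpp x')
| uc_mul x x' y y' : ucong x x' -> ucong y y' -> ucong (UMul x y) (UMul x' y')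
| uc_scale c x x' : ucong x x' -> ucong (UScale c x) (UScale c x')
| uc_addA x y z : ucong (UAdd x (UAdd y z)) (UAdd (UAdd x y) z)
| uc_addC x y : ucong (UAdd x y) (UAdd y x)
| uc_add0 x : ucong (UAdd UZero x) x
| uc_addN x : ucong (UAdd (UOpp x) x) UZero
| uc_mulA x y z : ucong (UMul x (UMul y z)) (UMul (UMul x y) z)
| uc_mul1l x : ucong (UMul UOne x) x
| uc_mul1r x : ucong (UMul x UOne) x
| uc_mulDl x y z : ucong (UMul (UAdd x y) z) (UAdd (UMul x z) (UMul y z))
| uc_mulDr x y z : ucong (UMul x (UAdd y z)) (UAdd (UMul x y) (UMul x z))
| uc_scaleA a b x : ucong (UScale a (UScale b x)) (UScale (a * b) x)
| uc_scale1 x : ucong (UScale 1 x) x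
| uc_scaleDr a x y : ucong (UScale a (UAdd x y)) (UAdd (UScale a x) (UScale a y))
| uc_scaleDl a b x : ucong (UScale (a + b) x) (UAdd (UScale a x) (UScale b x))
| uc_scaleAl a x y : ucong (UScale a (UMul x y)) (UMul (UScale a x) y)
| uc_scaleAr a x y : ucong (UScale a (UMul x y)) (UMul x (UScale a y))
| uc_genD x y : ucong (UGen (x + y)) (UAdd (UGen x) (UGen y))
| uc_genZ a x : ucong (UGen (a *: x)) (UScale a (UGen x))
| uc_lie x y : ucong (UGen (lieb x y))
    (UAdd (UMul (UGen x) (UGen y)) (UOpp (UMul (UGen y) (UGen x)))).

HB.instance Definition _ := gen_eqMixin uterm.
HB.instance Definition _ := gen_choiceMixin uterm.

Definition ucongb (x y : uterm) : bool := `[< ucong x y >].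
Fact ucong_equiv : equiv_class_of ucongb.
Proof.
split=> [x|x y|y x z]; first by apply/asboolP/uc_refl.
- by apply/asboolP/asboolP; apply: uc_sym.
- by move=> /asboolP xy /asboolP yz; apply/asboolP; apply: uc_trans xy yz.
Qed.
Canonical ucong_equivRel := EquivRelPack ucong_equiv.
Canonical ucong_encModRel := defaultEncModRel ucongb.

Definition uea : Type := {eq_quot ucongb}.
HB.instance Definition _ := Choice.on uea.
Definition ucl (x : uterm) : uea := \pi_{eq_quot ucongb} x.
Lemma uclP x y : ucl x = ucl y <-> ucong x y.
Proof.
rewrite /ucl; split=> [/eqP|h]; first by rewrite piE => /asboolP.
by apply/eqP; rewrite piE; apply/asboolP.
Qed.
Lemma uclK (x : uea) : ucl (repr x) = x. Proof. exact: reprK. Qed.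
Lemma urepr x : ucong (repr (ucl x)) x. Proof. by apply/uclP; rewrite uclK. Qed.

Definition uadd (x y : uea) : uea := ucl (UAdd (repr x) (repr y)).
Definition uopp (x : uea) : uea := ucl (UOpp (repr x)).
Definition umul (x y : uea) : uea := ucl (UMul (repr x) (repr y)).
Definition uscale (a : K) (x : uea) : uea := ucl (UScale a (repr x)).
Lemma uaddE x y : uadd (ucl x) (ucl y) = ucl (UAdd x y).
Proof. by apply/uclP/uc_add; apply: urepr. Qed.
Lemma uoppE x : uopp (ucl x) = ucl (UOpp x).
Proof. by apply/uclP/uc_opp; apply: urepr. Qed.
Lemma umulE x y : umul (ucl x) (ucl y) = ucl (UMul x y).
Proof. by apply/uclP/uc_mul; apply: urepr. Qed.
Lemma uscaleE a x : uscale a (ucl x) = ucl (UScale a x).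
Proof. by apply/uclP/uc_scale; apply: urepr. Qed.
Let uE := (uaddE, uoppE, umulE, uscaleE).

Fact uaddA : associative uadd.
Proof.
by move=> x y z; rewrite -(uclK x) -(uclK y) -(uclK z) !uE; apply/uclP/uc_addA.
Qed.
Fact uaddC : commutative uadd.
Proof. by move=> x y; rewrite -(uclK x) -(uclK y) !uE; apply/uclP/uc_addC. Qed.
Fact uadd0 : left_id (ucl UZero) uadd.
Proof. by move=> x; rewrite -(uclK x) uE; apply/uclP/uc_add0. Qed.
Fact uaddN : left_inverse (ucl UZero) uopp uadd.
Proof. by move=> x; rewrite -(uclK x) !uE; apply/uclP/uc_addN. Qed.
HB.instance Definition _ := GRing.isZmodule.Build uea uaddA uaddC uadd0 uaddN.

Fact umulA : associative umul.
Proof.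
by move=> x y z; rewrite -(uclK x) -(uclK y) -(uclK z) !uE; apply/uclP/uc_mulA.
Qed.
Fact umul1r : left_id (ucl UOne) umul.
Proof. by move=> x; rewrite -(uclK x) uE; apply/uclP/uc_mul1l. Qed.
Fact umulr1 : right_id (ucl UOne) umul.
Proof. by move=> x; rewrite -(uclK x) uE; apply/uclP/uc_mul1r. Qed.
Fact umulDl : left_distributive umul +%R.
Proof.
move=> x y z; rewrite -(uclK x) -(uclK y) -(uclK z) -![_ + _]/(uadd _ _) !uE.
by apply/uclP/uc_mulDl.
Qed.
Fact umulDr : right_distributive umul +%R.
Proof.
move=> x y z; rewrite -(uclK x) -(uclK y) -(uclK z) -![_ + _]/(uadd _ _) !uE.
by apply/uclP/uc_mulDr.
Qed.

Section Lift.
Variables (B : nzRingType) (s : {rmorphism K -> B}) (f : L -> B).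
Hypotheses (sC : forall a b, s a * b = b * s a).
Hypotheses (fD : {morph f : x y / x + y}) (fZ : forall a x, f (a *: x) = s a * f x).
Hypothesis (fL : forall x y, f (lieb x y) = f x * f y - f y * f x).
Fixpoint ueval (x : uterm) : B := match x with
  | UGen x => f x
  | UZero => 0
  | UOne => 1
  | UAdd x y => ueval x + ueval y
  | UOpp x => - ueval x
  | UMul x y => ueval x * ueval y
  | UScale a x => s a * ueval x
  end.
Lemma ueval_cong x y : ucong x y -> ueval x = ueval y.
Proof.
elim=> {x y} /=.
- by [].
- by move=> x y _ ->.
- by move=> x y z _ -> _ ->.
- by move=> x x' y y' _ -> _ ->.
- by move=> x x' _ ->.
- by move=> x x' y y' _ -> _ ->.
- by move=> c x x' _ ->.
- by move=> x y z; rewrite addrA.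
- by move=> x y; rewrite addrC.
- by move=> x; rewrite add0r.
- by move=> x; rewrite addNr.
- by move=> x y z; rewrite mulrA.
- by move=> x; rewrite mul1r.
- by move=> x; rewrite mulr1.
- by move=> x y z; rewrite mulrDl.
- by move=> x y z; rewrite mulrDr.
- by move=> a b x; rewrite rmorphM mulrA.
- by move=> x; rewrite rmorph1 mul1r.
- by move=> a x y; rewrite mulrDr.
- by move=> a b x; rewrite rmorphD mulrDl.
- by move=> a x y; rewrite mulrA.
- by move=> a x y; rewrite !mulrA sC.
- by move=> x y; rewrite fD.
- by move=> a x; rewrite fZ.
- by move=> x y; rewrite fL.
Qed.
End Lift.

Fact uone_neq0 : ucl UOne != ucl UZero.
Proof.
apply/eqP => /uclP h.
have hZ (a : K) (x : L) : 0 = a * 0 :> K by rewrite mulr0.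
have hL (x y : L) : 0 = 0 * 0 - 0 * 0 :> K by rewrite mulr0 subr0.
have hD : {morph (fun=> 0 : K) : x y / (x + y : L) >-> x + y}.
  by move=> x y; rewrite addr0.
have := @ueval_cong K idfun (fun=> 0) (fun a b => mulrC a b) hD hZ hL _ _ h.
by move/eqP; rewrite /= oner_eq0.
Qed.
HB.instance Definition _ := GRing.Zmodule_isNzRing.Build uea
  umulA umul1r umulr1 umulDl umulDr uone_neq0.

Fact uscalerA a b v : uscale a (uscale b v) = uscale (a * b) v.
Proof. by rewrite -(uclK v) !uE; apply/uclP/uc_scaleA. Qed.
Fact uscale1r : left_id 1 uscale.
Proof. by move=> v; rewrite -(uclK v) !uE; apply/uclP/uc_scale1. Qed.
Fact uscalerDr : right_distributive uscale +%R.
Proof.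
move=> a u v; rewrite -(uclK u) -(uclK v) -![_ + _]/(uadd _ _) !uE.
by apply/uclP/uc_scaleDr.
Qed.
Fact uscalerDl v : {morph uscale^~ v : a b / a + b}.
Proof.
move=> a b; rewrite -(uclK v) -[uscale a _ + _]/(uadd _ _) !uE.
by apply/uclP/uc_scaleDl.
Qed.
HB.instance Definition _ := GRing.Zmodule_isLmodule.Build K uea
  uscalerA uscale1r uscalerDr uscalerDl.
Fact uscalerAl a (u v : uea) : a *: (u * v) = (a *: u) * v.
Proof.
rewrite -(uclK u) -(uclK v).
by rewrite -![_ *: _]/(uscale _ _) -![_ * _]/(umul _ _) !uE; apply/uclP/uc_scaleAl.
Qed.
HB.instance Definition _ := GRing.Lmodule_isLalgebra.Build K uea uscalerAl.
Fact uscalerAr a (u v : uea) : a *: (u * v) = u * (a *: v).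
Proof.
rewrite -(uclK u) -(uclK v).
by rewrite -![_ *: _]/(uscale _ _) -![_ * _]/(umul _ _) !uE; apply/uclP/uc_scaleAr.
Qed.
HB.instance Definition _ := GRing.Lalgebra_isAlgebra.Build K uea uscalerAr.

Lemma uclD x y : ucl x + ucl y = ucl (UAdd x y). Proof. exact: uaddE. Qed.
Lemma uclN x : - ucl x = ucl (UOpp x). Proof. exact: uoppE. Qed.
Lemma uclM x y : ucl x * ucl y = ucl (UMul x y). Proof. exact: umulE. Qed.
Lemma uclZ a x : a *: ucl x = ucl (UScale a x). Proof. exact: uscaleE. Qed.

Definition ugen (x : L) : uea := ucl (UGen x).
Fact ugen_linear : linear ugen.
Proof.
move=> a x y; rewrite /ugen uclZ uclD.
apply/uclP; apply: uc_trans (uc_genD _ _) _.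
by apply: uc_add; [apply: uc_genZ | apply: uc_refl].
Qed.
HB.instance Definition _ := GRing.isLinear.Build K L uea *:%R ugen ugen_linear.
Lemma ugen_lie x y : ugen (lieb x y) = ugen x * ugen y - ugen y * ugen x.
Proof.
by rewrite /ugen !uclM uclN uclD; apply/uclP/uc_lie.
Qed.

Lemma uea_ind (P : uea -> Prop) :
  (forall x, P (ugen x)) -> (forall a, P a%:A) ->
  (forall x y, P x -> P y -> P (x + y)) -> (forall x y, P x -> P y -> P (x * y)) ->
  forall x, P x.
Proof.
move=> hg ha hD hM x; rewrite -(uclK x).
have hZ a y : P y -> P (a *: y) by move=> Py; rewrite -[y]mul1r scalerAl; apply: hM.
elim: (repr x) => [y|||y hy z hz|y hy|y hy z hz|a y hy].
- exact: hg.
- by have := ha 0; rewrite scale0r.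
- by have := ha 1; rewrite scale1r.
- by rewrite -uclD; apply: hD.
- by rewrite -uclN -scaleN1r; apply: hZ.
- by rewrite -uclM; apply: hM.
- by rewrite -uclZ; apply: hZ.
Qed.

Lemma uea_comm : (forall x y : L, lieb x y = 0) -> forall u v : uea, u * v = v * u.
Proof.
move=> hL u v; elim/uea_ind: u => [x|a|x y hx hy|x y hx hy].
- elim/uea_ind: v => [y|a|y z hy hz|y z hy hz].
  + by apply/eqP; rewrite -subr_eq0 -ugen_lie hL linear0.
  + by rewrite -scalerAr -scalerAl mul1r mulr1.
  + by rewrite mulrDl mulrDr hy hz.
  + by rewrite mulrA hy -mulrA hz mulrA.
- by rewrite -scalerAr -scalerAl mul1r mulr1.
- by rewrite mulrDl mulrDr hx hy.
- by rewrite -mulrA hy mulrA hx -mulrA.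
Qed.
End Enveloping.

Section EnvelopingLift.
Variables (K : comNzRingType) (L : lieAlgType K) (B : algType K).
Variable (f : {linear L -> B}).
Hypothesis (fL : forall x y, f (lieb x y) = f x * f y - f y * f x).
Let s : {rmorphism K -> B} := in_alg B.
Fact ulift_sC a b : s a * b = b * s a.
Proof. by rewrite /s /= -scalerAl -scalerAr mul1r mulr1. Qed.
Fact ulift_fZ a x : f (a *: x) = s a * f x.
Proof. by rewrite linearZ /s /= -scalerAl mul1r. Qed.
Definition uea_lift of (forall x y, f (lieb x y) = f x * f y - f y * f x) :=
  fun x : uea L => ueval s f (repr x).
Let F := uea_lift fL.
Lemma uea_lift_cl x : F (ucl x) = ueval s f x.
Proof. exact: (ueval_cong ulift_sC (linearD f) ulift_fZ fL (urepr x)). Qed.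
Lemma uea_lift_gen x : F (ugen x) = f x. Proof. exact: uea_lift_cl. Qed.
Fact uea_lift_linear : linear F.
Proof.
move=> a x y; rewrite -(uclK x) -(uclK y) uclZ uclD !uea_lift_cl /=.
by rewrite /s /= -scalerAl mul1r.
Qed.
Fact uea_lift_monoid : monoid_morphism F.
Proof.
split; first exact: (uea_lift_cl (UOne L)).
move=> x y; rewrite -(uclK x) -(uclK y).
by rewrite uclM !uea_lift_cl.
Qed.
HB.instance Definition _ := GRing.isLinear.Build K (uea L) B *:%R (uea_lift fL)
  uea_lift_linear.
HB.instance Definition _ := GRing.isMonoidMorphism.Build (uea L) B (uea_lift fL)
  uea_lift_monoid.
End EnvelopingLift.

Section EnvelopingMap.
Variables (K : comNzRingType) (L L' : lieAlgType K) (f : lieHom L L').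
Definition ugen_comp (x : L) : uea L' := ugen (f x).
Fact ugen_comp_linear : linear ugen_comp.
Proof. by move=> a x y; rewrite /ugen_comp !linearP. Qed.
HB.instance Definition _ := GRing.isLinear.Build K L (uea L') *:%R ugen_comp
  ugen_comp_linear.
Fact ugen_comp_lie x y :
  ugen_comp (lieb x y) = ugen_comp x * ugen_comp y - ugen_comp y * ugen_comp x.
Proof. by rewrite /ugen_comp lie_funP ugen_lie. Qed.
Definition uea_map : {lrmorphism uea L -> uea L'} := uea_lift ugen_comp_lie.
Lemma uea_map_gen x : uea_map (ugen x) = ugen (f x).
Proof. exact: uea_lift_gen. Qed.
End EnvelopingMap.

Record category := Category {
  obj :> Type;
  hom : obj -> obj -> Type;
  idm : forall X, hom X X;
  compm : forall X Y Z, hom Y Z -> hom X Y -> hom X Z;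
  comp1m : forall X Y (f : hom X Y), compm (idm Y) f = f;
  compm1 : forall X Y (f : hom X Y), compm f (idm X) = f;
  compA : forall X Y Z T (f : hom Z T) (g : hom Y Z) (h : hom X Y),
    compm f (compm g h) = compm (compm f g) h }.

Record functor (C D : category) := Functor {
  fobj :> C -> D;
  fmor : forall X Y, hom X Y -> hom (fobj X) (fobj Y);
  fmor1 : forall X, fmor (idm X) = idm (fobj X);
  fmorM : forall X Y Z (f : hom Y Z) (g : hom X Y),
    fmor (compm f g) = compm (fmor f) (fmor g) }.

Definition functor_id (C : category) : functor C C :=
  @Functor C C id (fun X Y f => f) (fun X => erefl) (fun X Y Z f g => erefl).

Section FunctorComp.
Variables (C D E : category) (G : functor D E) (F : functor C D).
Fact fcomp1 X : fmor G (fmor F (idm X)) = idm (G (F X)).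
Proof. by rewrite !fmor1. Qed.
Fact fcompM X Y Z (f : hom Y Z) (g : hom X Y) :
  fmor G (fmor F (compm f g)) = compm (fmor G (fmor F f)) (fmor G (fmor F g)).
Proof. by rewrite !fmorM. Qed.
Definition functor_comp : functor C E :=
  @Functor C E (fun X => G (F X)) (fun X Y f => fmor G (fmor F f)) fcomp1 fcompM.
End FunctorComp.

Record nat_trans (C D : category) (F G : functor C D) := NatTrans {
  ntrans :> forall X : C, hom (F X) (G X);
  ntransP : forall (X Y : C) (f : hom X Y),
    compm (ntrans Y) (fmor F f) = compm (fmor G f) (ntrans X) }.

Definition right_adjoint (C D : category) (R : functor D C) (L : functor C D) : Prop :=
  exists phi : forall (X : C) (Y : D), hom (L X) Y -> hom X (R Y),
    [/\ forall X Y, bijective (phi X Y),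
        forall (X X' : C) (Y : D) (f : hom X' X) (k : hom (L X) Y),
          phi X' Y (compm k (fmor L f)) = compm (phi X Y k) f
      & forall (X : C) (Y Y' : D) (f : hom Y Y') (k : hom (L X) Y),
          phi X Y' (compm f k) = compm (fmor R f) (phi X Y k) ].

Lemma linear_ext (R : pzRingType) (U V : lmodType R) (f g : {linear U -> V}) :
  f =1 g -> f = g.
Proof.
case: f g => [f [[fa] [fs]]] [g [[ga] [gs]]] /= /funext fg.
move: fa fs ga gs; rewrite fg => fa fs ga gs.
by rewrite (Prop_irrelevance fa ga) (Prop_irrelevance fs gs).
Qed.

Section ModuleCategory.
Variables (R : pzRingType) (I : Type) (M : I -> lmodType R).
Let mhom i j := {linear M i -> M j}.
Let mid i : mhom i i := idfun.
Let mcomp i j k (f : mhom j k) (g : mhom i j) : mhom i k := f \o g.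
Fact mcomp1m i j (f : mhom i j) : mcomp (mid j) f = f.
Proof. exact: linear_ext. Qed.
Fact mcompm1 i j (f : mhom i j) : mcomp f (mid i) = f.
Proof. exact: linear_ext. Qed.
Fact mcompA i j k l (f : mhom k l) (g : mhom j k) (h : mhom i j) :
  mcomp f (mcomp g h) = mcomp (mcomp f g) h.
Proof. exact: linear_ext. Qed.
Definition lin_category : category := Category mcomp1m mcompm1 mcompA.
End ModuleCategory.

Definition mod_category (R : pzRingType) : category :=
  lin_category (fun M : lmodType R => M).

Section SimpleLie.
Variables (K : fieldType) (g : lieVectType K).

Definition lie_ideal (I : {vspace g}) : Prop :=
  forall x y, y \in I -> lieb x y \in I.

Definition lie_simple : Prop :=
  (exists x y : g, lieb x y != 0) /\
  forall I : {vspace g}, lie_ideal I -> I = 0%VS \/ I = fullv.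

Record lieSubalg := LieSubalg {
  subalg_vs :> {vspace g};
  subalg_lie : forall x y, x \in subalg_vs -> y \in subalg_vs ->
    lieb x y \in subalg_vs }.

Section Subalgebra.
Variable s : lieSubalg.
Definition sub_lie : Type := subvs_of s.
HB.instance Definition _ := Vector.on sub_lie.
Definition sub_bracket (x y : sub_lie) : sub_lie :=
  Subvs (subalg_lie (subvsP x) (subvsP y)).
Lemma sub_bracketE x y : vsval (sub_bracket x y) = lieb (vsval x) (vsval y).
Proof. by []. Qed.
Fact sub_linearl y : linear (sub_bracket^~ y).
Proof.
by move=> a x z; apply: val_inj; rewrite /= liebDl liebZl.
Qed.
Fact sub_linearr x : linear (sub_bracket x).
Proof. by move=> a y z; apply: val_inj; rewrite /= liebDr liebZr. Qed.
Fact sub_bracketxx x : sub_bracket x x = 0.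
Proof. by apply: val_inj; rewrite /= liebxx. Qed.
Fact sub_jacobi x y z : sub_bracket x (sub_bracket y z) +
  sub_bracket y (sub_bracket z x) + sub_bracket z (sub_bracket x y) = 0.
Proof. by apply: val_inj; rewrite /= lieb_jacobi. Qed.
HB.instance Definition _ := Lmodule_isLie.Build K sub_lie
  sub_linearl sub_linearr sub_bracketxx sub_jacobi.

Definition sub_incl (x : sub_lie) : g := vsval x.
Fact sub_incl_linear : linear sub_incl. Proof. by []. Qed.
HB.instance Definition _ := GRing.isLinear.Build K sub_lie g *:%R sub_incl
  sub_incl_linear.
Fact sub_incl_lie x y : sub_incl (lieb x y) = lieb (sub_incl x) (sub_incl y).
Proof. by []. Qed.
Definition sub_hom : lieHom sub_lie g := LieHom sub_incl_lie.
End Subalgebra.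

(* Cartan subalgebras of a semisimple Lie algebra: commutative, equal to their *)
(* own centralizer, and acting diagonalizably in the adjoint representation.   *)
Record cartan := Cartan {
  cartan_subalg :> lieSubalg;
  cartan_abelian : forall x y, x \in subalg_vs cartan_subalg ->
    y \in subalg_vs cartan_subalg -> lieb x y = 0;
  cartan_centralizer : forall x,
    (forall y, y \in subalg_vs cartan_subalg -> lieb y x = 0) ->
    x \in subalg_vs cartan_subalg;
  cartan_diag : forall x, x \in subalg_vs cartan_subalg ->
    exists2 b : seq g, basis_of fullv b &
      forall y, y \in b -> exists c : K, lieb x y = c *: y }.

Section Weights.
Variable h : cartan.
Definition hdual := 'Hom(sub_lie h, K^o).
Implicit Types (beta mu nu : hdual) (t : sub_lie h).

Definition root_space beta (x : g) : Prop :=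
  forall t, lieb (sub_incl t) x = (beta t : K) *: x.
Definition is_root beta : Prop :=
  beta != 0 /\ exists2 x, x != 0 & root_space beta x.
Definition is_coroot beta t : Prop :=
  (beta t : K) = 2 /\
  exists x y, [/\ root_space beta x, root_space (- beta) y & lieb x y = sub_incl t].

Variables (n : nat) (alpha : n.-tuple hdual).
Definition Qplus mu : Prop :=
  exists k : 'I_n -> nat, mu = \sum_i tnth alpha i *+ k i.
Definition wle mu nu : Prop := Qplus (nu - mu).
Definition simple_roots : Prop :=
  [/\ basis_of fullv alpha,
      forall i, is_root (tnth alpha i)
    & forall beta, is_root beta -> Qplus beta \/ Qplus (- beta)].

Variable omega : n.-tuple hdual.
Definition fundamental_weights : Prop :=
  forall i j, exists2 t, is_coroot (tnth alpha j) t
                       & (tnth omega i t : K) = (i == j)%:R.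
Definition Pplus mu : Prop :=
  exists k : 'I_n -> nat, mu = \sum_i tnth omega i *+ k i.
End Weights.

Section Modules.
Variables (h : cartan) (V : lmodType (uea g)).

Definition weight_space (mu : hdual h) (v : V) : Prop :=
  forall t, ugen (sub_incl t) *: v = (mu t : K)%:A *: v.

Definition in_span (s : seq V) (v : V) : Prop :=
  exists c : 'I_(size s) -> K, v = \sum_i (c i)%:A *: s`_i.
Definition finite_dim : Prop := exists s : seq V, forall v, in_span s v.
Definition locally_finite_dim : Prop :=
  forall v, exists s : seq V, in_span s v /\
    forall (x : g) w, in_span s w -> in_span s (ugen x *: w).
Definition irreducible : Prop :=
  (exists v : V, v != 0) /\
  forall N : submodule V, (forall v, v \in submod_mem N -> v = 0) \/
                          (forall v, v \in submod_mem N).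
End Modules.

Record hw_irrep (h : cartan) (n : nat) (alpha : n.-tuple (hdual h))
    (lambda : hdual h) := HwIrrep {
  irrep_mod :> lmodType (uea g);
  hwv : irrep_mod;
  irrep_fin_dim : finite_dim irrep_mod;
  irrep_irreducible : irreducible irrep_mod;
  hwv_neq0 : hwv != 0;
  hwv_weight : weight_space lambda hwv;
  hwv_highest : forall beta x, is_root beta -> Qplus alpha beta ->
    root_space beta x -> ugen x *: hwv = 0 }.
End SimpleLie.

(* U(g (x) A)-modules; their g-module structure is by restriction along        *)
(* U(g) -> U(g (x) A), x |-> x (x) 1.                                           *)
Section CategoryI.
Variables (K : fieldType) (g : lieVectType K) (h : cartan g).
Variables (n : nat) (alpha : n.-tuple (hdual h)) (A : comAlgType K).
Local Notation UgA := (uea (current g A)).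

Definition uincl : {lrmorphism uea g -> UgA} := uea_map (cur1_hom g A).
Definition gmod (V : lmodType UgA) : lmodType (uea g) := restr_scalars uincl V.
Definition cweight (V : lmodType UgA) (mu : hdual h) (v : V) : Prop :=
  weight_space (V := gmod V) mu v.
Definition in_I (V : lmodType UgA) : Prop := locally_finite_dim (gmod V).

Section Truncation.
Variables (V : lmodType UgA) (nu : hdual h).

(* membership in the sum of the U(g (x) A) V_mu over all mu not <= nu *)
Definition trunc_mem (x : V) : Prop :=
  exists2 s : seq (UgA * V),
    (forall p, p \in s -> exists2 mu, ~ wle alpha mu nu & cweight mu p.2)
    & x = \sum_(p <- s) p.1 *: p.2.
Fact trunc_closed : GRing.submod_closed [pred x | `[< trunc_mem x >]].
Proof.
split=> [|a x y]; first by apply/asboolP; exists [::]; rewrite ?big_nil.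
move=> /asboolP[s hs ->] /asboolP[s' hs' ->]; apply/asboolP.
exists ([seq (a * p.1, p.2) | p <- s] ++ s') => [p|].
  by rewrite mem_cat => /orP[/mapP[q qs ->]|/hs'//]; exact: (hs q qs).
rewrite big_cat big_map scaler_sumr /=; congr (_ + _).
by apply: eq_bigr => p _; rewrite scalerA.
Qed.
Definition trunc_sub : submodule V := Submodule trunc_closed.
Definition truncation : lmodType UgA := quotmod trunc_sub.
End Truncation.

(* V = V^nu *)
Definition in_I_le (nu : hdual h) (V : lmodType UgA) : Prop :=
  in_I V /\ forall v : V, trunc_mem nu v -> v = 0.
Record I_obj (nu : hdual h) := IObj { I_mod :> lmodType UgA; I_modP : in_I_le nu I_mod }.
Definition I_category (nu : hdual h) : category := lin_category (@I_mod nu).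
End CategoryI.

Section Weyl.
Variables (K : fieldType) (g : lieVectType K) (h : cartan g).
Variables (n : nat) (alpha : n.-tuple (hdual h)) (lambda : hdual h).
Variables (Vl : hw_irrep alpha lambda) (A : comAlgType K).
Local Notation UgA := (uea (current g A)).
Local Notation UhA := (uea (current (sub_lie h) A)).

Definition hincl : {lrmorphism UhA -> UgA} := uea_map (current_hom (sub_hom h) A).

Lemma hA_abelian (x y : current (sub_lie h) A) : lieb x y = 0.
Proof.
elim/cur_ind: x => [x a|x x' hx hx']; last by rewrite liebDl hx hx' addr0.
elim/cur_ind: y => [y b|y y' hy hy']; last by rewrite liebDr hy hy' addr0.
rewrite lieb_cur; have -> : lieb x y = 0.
  by apply: val_inj; apply: cartan_abelian; exact: subvsP.
exact: (@pure0l K K (scalar_bimod (sub_lie h)) A).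
Qed.
Lemma UhA_comm (u v : UhA) : u * v = v * u.
Proof. exact: (uea_comm hA_abelian). Qed.

Definition induced_module : lmodType UgA := tensor (regular_bimod (uincl g A)) Vl.
Definition global_weyl : lmodType UgA := truncation alpha induced_module lambda.
Definition weyl_gen : global_weyl :=
  qproj _ (@pure _ _ (regular_bimod (uincl g A)) Vl 1 (hwv Vl)).

Definition annh : {pred UhA} := [pred u | hincl u *: weyl_gen == 0].
Fact annh_zmod : GRing.zmod_closed annh.
Proof.
split=> [|u v]; first by rewrite inE linear0 scale0r.
by rewrite !inE => /eqP hu /eqP hv; rewrite linearB scalerBl hu hv subrr.
Qed.
Fact annhMl a u : u \in annh -> a * u \in annh.
Proof. by rewrite !inE => /eqP hu; rewrite rmorphM -scalerA hu scaler0. Qed.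
Fact annhMr a u : u \in annh -> u * a \in annh.
Proof. by rewrite UhA_comm; exact: annhMl. Qed.
Definition Annh : ideal UhA := Ideal annh_zmod annhMl annhMr.

Definition Alambda : Type := quotring Annh.
HB.instance Definition _ := GRing.PzRing.on Alambda.
Fact Alambda_comm : commutative (@GRing.mul Alambda).
Proof.
move=> x y; rewrite -(rprojK x) -(rprojK y).
by rewrite -!rprojM UhA_comm.
Qed.
HB.instance Definition _ := GRing.PzRing_hasCommutativeMul.Build Alambda Alambda_comm.

Lemma irrep_cyclic (v : Vl) : exists x : uea g, v = x *: hwv Vl.
Proof.
have hcl : GRing.submod_closed [pred v : Vl | `[< exists x, v = x *: hwv Vl >]].
  split=> [|a v' w]; first by apply/asboolP; exists 0; rewrite scale0r.
  move=> /asboolP[x ->] /asboolP[y ->]; apply/asboolP; exists (a * x + y).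
  by rewrite scalerDl scalerA.
have [_ /(_ (Submodule hcl)) []] := irrep_irreducible Vl.
  move=> /(_ (hwv Vl)) hN; case/eqP: (hwv_neq0 Vl); apply: hN.
  by apply/asboolP; exists 1; rewrite scale1r.
by move=> /(_ v) /asboolP.
Qed.

Lemma weyl_cyclic (z : global_weyl) : exists u : UgA, z = u *: weyl_gen.
Proof.
rewrite -(qprojK z).
suff [u ->] : exists u : UgA, repr z =
    u *: @pure _ _ (regular_bimod (uincl g A)) Vl 1 (hwv Vl).
  by exists u; rewrite linearZ.
move: (repr z : tensor _ _); elim/tensor_ind => [m v|x y [u ->] [u' ->]].
  have [x ->] := irrep_cyclic v; exists (m * uincl g A x).
  by rewrite -pure_bal -pureZl; congr pure; rewrite /= -[RHS]/(_ * _) mulr1.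
by exists (u + u'); rewrite scalerDl.
Qed.

(* The right action of A_lambda on W_A(lambda) is prescribed on a generator:    *)
(* (u w) x := (u x) w. This is the condition for it to be well defined.         *)
Definition right_action_wd : Prop := forall (u : UgA) (x : UhA),
  u *: weyl_gen = 0 -> (u * hincl x) *: weyl_gen = 0.

Section Bimodule.
Hypothesis wd : right_action_wd.
Definition weyl_ract of right_action_wd := fun (z : global_weyl) (a : Alambda) =>
  (projT1 (cid (weyl_cyclic z)) * hincl (repr a)) *: weyl_gen : global_weyl.
Lemma weyl_ractE u x :
  weyl_ract wd (u *: weyl_gen) (rproj _ x) = (u * hincl x) *: weyl_gen.
Proof.
rewrite /weyl_ract; case: cid => u' /= hu'.
have ha : hincl (repr (rproj Annh x : Alambda)) *: weyl_gen = hincl x *: weyl_gen.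
  apply/eqP; rewrite -subr_eq0 -scalerBl -linearB.
  by have /rprojP := rprojK (rproj Annh x); rewrite inE.
rewrite -scalerA ha scalerA; apply/eqP; rewrite -subr_eq0 -scalerBl -mulrBl.
by apply/eqP/wd; rewrite scalerBl -hu' subrr.
Qed.
Let Q := weyl_ractE.
Fact weyl_ractDl a : {morph (weyl_ract wd)^~ a : x y / x + y}.
Proof.
move=> x y; have [u ->] := weyl_cyclic x; have [v ->] := weyl_cyclic y.
by rewrite -(rprojK a) -scalerDl !Q mulrDl scalerDl.
Qed.
Fact weyl_ractDr x : {morph weyl_ract wd x : a b / a + b}.
Proof.
move=> a b; have [u ->] := weyl_cyclic x; rewrite -(rprojK a) -(rprojK b).
by rewrite -[rproj _ _ + _]rprojD !Q rmorphD mulrDr scalerDl.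
Qed.
Fact weyl_ract1 x : weyl_ract wd x 1 = x.
Proof.
have [u ->] := weyl_cyclic x.
by rewrite -[1 : Alambda]/(rproj Annh 1) Q rmorph1 mulr1.
Qed.
Fact weyl_ractA x a b : weyl_ract wd (weyl_ract wd x a) b = weyl_ract wd x (a * b).
Proof.
have [u ->] := weyl_cyclic x; rewrite -(rprojK a) -(rprojK b).
by rewrite -[rproj _ _ * _]rprojM (Q u (repr a)) Q (Q u) rmorphM mulrA.
Qed.
Fact weyl_ractZ s x a : weyl_ract wd (s *: x) a = s *: weyl_ract wd x a.
Proof.
have [u ->] := weyl_cyclic x; rewrite -(rprojK a).
by rewrite scalerA Q Q scalerA mulrA.
Qed.
Definition weyl_bimod : bimodule UgA Alambda :=
  Bimodule weyl_ractDl weyl_ractDr weyl_ract1 weyl_ractA weyl_ractZ.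

Definition weyl_obj (M : lmodType Alambda) : lmodType UgA := tensor weyl_bimod M.
Definition weyl_pure (M : lmodType Alambda) (z : global_weyl) (m : M) : weyl_obj M :=
  @pure _ _ weyl_bimod M z m.
Definition weyl_lands : Prop :=
  forall M : lmodType Alambda, in_I_le alpha lambda (weyl_obj M).

Section WeylFunctor.
Hypothesis lands : weyl_lands.
Definition weyl_fobj (M : mod_category Alambda) : I_category alpha A lambda :=
  IObj (lands M).
Definition weyl_fmor (M N : mod_category Alambda) (f : hom M N) :
  hom (weyl_fobj M) (weyl_fobj N) :=
  @tensor_map _ _ weyl_bimod M N f.
Fact weyl_fmor1 M : weyl_fmor (idm M) = idm (weyl_fobj M).
Proof.
apply: linear_ext; elim/tensor_ind => [z m|x y hx hy]; first exact: tensor_map_pure.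
by rewrite !linearD hx hy.
Qed.
Fact weyl_fmorM M N P (f : hom N P) (k : hom M N) :
  weyl_fmor (compm f k) = compm (weyl_fmor f) (weyl_fmor k).
Proof.
apply: linear_ext; elim/tensor_ind => [z m|x y hx hy].
  by rewrite /= !tensor_map_pure.
by rewrite !linearD hx hy.
Qed.
Definition weyl_functor : functor (mod_category Alambda) (I_category alpha A lambda) :=
  Functor weyl_fmor1 weyl_fmorM.
End WeylFunctor.
End Bimodule.

Definition Ann_kills : Prop :=
  forall V : lmodType UgA, in_I_le alpha lambda V ->
  forall (v : V) (u : UhA), cweight lambda v -> u \in annh -> hincl u *: v = 0.

Section WeightFunctor.
Hypothesis kill : Ann_kills.

Section OnObjects.
Variable V : I_obj alpha A lambda.
Definition wt_pred : {pred V} := [pred v | `[< cweight lambda v >]].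
Lemma wt_predP (v : V) : reflect
  (forall t : sub_lie h, ugen (cur (sub_incl t) (1 : A)) *: v
     = ((lambda t : K)%:A : UgA) *: v) (v \in wt_pred).
Proof.
have e1 x : ugen (cur x 1) = uincl g A (ugen x) by rewrite uea_map_gen.
have e2 (c : K) : c%:A = uincl g A c%:A by rewrite rmorph_alg.
by apply: (iffP (asboolP _)) => hv t; have := hv t; rewrite ?e1 ?e2.
Qed.
Fact wt_zmod : GRing.zmod_closed wt_pred.
Proof.
split=> [|v w /wt_predP hv /wt_predP hw]; apply/wt_predP => t.
  by rewrite !scaler0.
by rewrite !scalerBr hv hw.
Qed.
HB.instance Definition _ := GRing.isZmodClosed.Build V wt_pred wt_zmod.
Lemma wt_stable (u : UhA) (v : V) : v \in wt_pred -> hincl u *: v \in wt_pred.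
Proof.
move=> /wt_predP hv; apply/wt_predP => t.
have e : ugen (cur (sub_incl t) 1) = hincl (ugen (cur t 1)).
  by rewrite uea_map_gen /= current_map_cur.
have c : hincl (ugen (cur t 1)) *: (hincl u *: v) =
         hincl u *: (hincl (ugen (cur t 1)) *: v).
  by rewrite !scalerA -!rmorphM UhA_comm.
have hv' := hv t; rewrite e in hv'.
by rewrite e c hv' !scalerA -scalerAl mul1r -scalerAr mulr1.
Qed.

Record wt_mod (k : Ann_kills) : Type := WtMod { wt_val : V; wt_valP : wt_val \in wt_pred }.
HB.instance Definition _ k := [isSub for @wt_val k].
HB.instance Definition _ k := [Choice of wt_mod k by <:].
HB.instance Definition _ k := [SubChoice_isSubZmodule of wt_mod k by <:].

Lemma wt_val_inj k : injective (@wt_val k). Proof. exact: val_inj. Qed.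
Lemma wt_valD k (x y : wt_mod k) : wt_val (x + y) = wt_val x + wt_val y.
Proof. by []. Qed.

Definition wt_scale (a : Alambda) (v : wt_mod kill) : wt_mod kill :=
  WtMod kill (wt_stable (repr a) (wt_valP v)).
Lemma wt_scaleE u v : wt_val (wt_scale (rproj _ u) v) = hincl u *: wt_val v.
Proof.
apply/eqP; rewrite -subr_eq0 -scalerBl -linearB; apply/eqP.
apply: (kill (I_modP V)); first exact/asboolP/wt_valP.
by have /rprojP := rprojK (rproj Annh u).
Qed.
Let Q := wt_scaleE.
Fact wt_scalerA a b v : wt_scale a (wt_scale b v) = wt_scale (a * b) v.
Proof.
apply: wt_val_inj; rewrite -(rprojK a) -(rprojK b) -[rproj _ _ * _]rprojM.
by rewrite !Q scalerA rmorphM.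
Qed.
Fact wt_scale1r : left_id 1 wt_scale.
Proof.
by move=> v; apply: wt_val_inj; rewrite -[1]/(rproj Annh 1) Q rmorph1 scale1r.
Qed.
Fact wt_scalerDr : right_distributive wt_scale +%R.
Proof.
move=> a u v; apply: wt_val_inj; rewrite -(rprojK a).
by rewrite wt_valD !Q wt_valD scalerDr.
Qed.
Fact wt_scalerDl v : {morph wt_scale^~ v : a b / a + b}.
Proof.
move=> a b; apply: wt_val_inj; rewrite -(rprojK a) -(rprojK b) -[rproj _ _ + _]rprojD.
by rewrite wt_valD !Q rmorphD scalerDl.
Qed.
HB.instance Definition _ := GRing.Zmodule_isLmodule.Build Alambda (wt_mod kill)
  wt_scalerA wt_scale1r wt_scalerDr wt_scalerDl.
End OnObjects.

Section OnMorphisms.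
Variables (V W : I_category alpha A lambda) (f : hom V W).
Fact wt_map_subproof (v : wt_mod V kill) :
  (f : {linear I_mod V -> I_mod W}) (wt_val v) \in @wt_pred W.
Proof.
have /wt_predP hv := wt_valP v; apply/wt_predP => t.
by rewrite -!linearZ hv.
Qed.
Definition wt_map (v : wt_mod V kill) : wt_mod W kill := WtMod kill (wt_map_subproof v).
Fact wt_map_linear : linear wt_map.
Proof.
by move=> a u v; apply: val_inj; rewrite /= linearD linearZ.
Qed.
HB.instance Definition _ := GRing.isLinear.Build Alambda (wt_mod V kill) (wt_mod W kill)
  *:%R wt_map wt_map_linear.
End OnMorphisms.

Definition wt_fobj (V : I_category alpha A lambda) : mod_category Alambda := wt_mod V kill.
Definition wt_fmor (V W : I_category alpha A lambda) (f : hom V W) :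
  hom (wt_fobj V) (wt_fobj W) := wt_map f.
Fact wt_fmor1 V : wt_fmor (idm V) = idm (wt_fobj V).
Proof. by apply: linear_ext => v; apply: wt_val_inj. Qed.
Fact wt_fmorM V W X (f : hom W X) (k : hom V W) :
  wt_fmor (compm f k) = compm (wt_fmor f) (wt_fmor k).
Proof. by apply: linear_ext => v; apply: val_inj. Qed.
Definition weight_functor : functor (I_category alpha A lambda) (mod_category Alambda) :=
  Functor wt_fmor1 wt_fmorM.
End WeightFunctor.
End Weyl.

(* Main.v *)
Require Import Defs.
From HB Require Import structures.
From mathcomp Require Import all_boot all_order all_algebra.
From mathcomp Require Import boolp reals complex.
From mathcomp Require Import ring.

Set Implicit Arguments.
Unset Strict Implicit.
Unset Printing Implicit Defensive.

Import GRing.Theory Num.Theory passmx.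
Local Open Scope ring_scope.

(** The counit has to be u w_lambda (x) v |-> u v, and everything hinges on this
being well defined, that is on the universal property of the global Weyl
module ([weyl_universal]): whenever V lies in I_A^lambda and v is a vector of
weight lambda in V, some map W_A(lambda) -> V of g (x) A-modules sends w_lambda
to v.  Granting it, an element of U(h (x) A) that kills w_lambda kills v, so
A_lambda acts on the weight space of weight lambda; applied to V = W_A(lambda)
and v = x w_lambda it makes the right action of A_lambda on W_A(lambda) well
defined; and it makes the counit well defined.  The adjunction is then formal:
a map k out of W_A(lambda) (x) M corresponds to m |-> k (w_lambda (x) m).

As W_A(lambda) is a truncation of an induced module, the universal property
comes down to a statement about g alone ([hw_hom]): if v is a vector of weight
lambda in a locally finite g-module and positive root vectors kill v, there is
a g-map V(lambda) -> V sending v_lambda to v.  Let D be the cyclic submodule of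
V(lambda) x V generated by (v_lambda, v).  It projects onto V(lambda), and its
part of weight lambda is the line through (v_lambda, v), because D is spanned by
what negative root vectors make of the generator ([hw_top]).  If D -> V(lambda)
splits, the splitting sends v_lambda to a multiple of (v_lambda, v), which has to
be (v_lambda, v) itself, and the second projection is the map sought.

That D -> V(lambda) splits is complete reducibility, obtained here from
Whitehead's first lemma: every 1-cocycle phi : g -> W with values in a finite
dimensional module is a coboundary ([whitehead]; the cocycle measures how far a
linear section is from being a g-map).  By induction on dim W one may take W
irreducible and nontrivial.  Then the trace form tr (x y) on W is nondegenerate:
its radical is an ideal, and it does not contain the element T of an sl_2-triple
(X, Y, T), since T acts diagonally with integer eigenvalues that are not all
zero.  With dual bases e_i, e'_i for this form, the Casimir operator
C = sum e_i e'_i commutes with g and has trace dim g, so it is invertible on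
W; and w_0 = sum e_i phi(e'_i) satisfies x w_0 = C phi(x), so that
phi(x) = x (C^-1 w_0).

Finally W_A(lambda) (x) M lies in I_A^lambda: local finiteness and being a sum of
weight vectors pass from a generator to the module that it generates over
U(g (x) A), the truncation leaves W_A(lambda) with weights <= lambda only, and
both properties pass to sums of images of W_A(lambda) ([lf_vector_uea],
[wsum_uea], [weyl_wsum]). *)

(** * Linear algebra *)

(** Turns a classically given subspace into one with a computable dimension: take a
subspace of the largest dimension among those that lie in it. *)
Lemma pred_vspace (K : fieldType) (W : vectType K) (P : W -> Prop) :
  P 0 -> (forall a x y, P x -> P y -> P (a *: x + y)) ->
  exists U : {vspace W}, forall x, x \in U <-> P x.
Proof.
move=> P0 PD.
pose Q := fun d : nat => `[< exists2 U : {vspace W}, (forall x, x \in U -> P x) & \dim U = d >].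
have exQ : exists d, Q d.
  exists 0%N; apply/asboolP; exists 0%VS; last exact: dimv0.
  by move=> x; rewrite memv0 => /eqP ->.
have bQ d : Q d -> (d <= \dim {:W})%N.
  by move=> /asboolP[U _ <-]; apply: dimvS; apply: subvf.
case: (ex_maxnP exQ bQ) => d /asboolP[U UP dU] dmax.
exists U => x; split=> [|Px]; first exact: UP.
have : (\dim (U + <[x]>) <= \dim U)%N.
  rewrite dU; apply: dmax; apply/asboolP; exists (U + <[x]>)%VS => // y.
  move=> /memv_addP[u uU [_ /vlineP[k ->] ->]].
  by rewrite addrC; apply: PD => //; apply: UP.
rewrite (geq_leqif (dimv_leqif_sup (addvSl _ _))) => /subvP; apply.
by apply: (subvP (addvSr _ _)); rewrite memv_line.
Qed.

Section Trace.
Variables (K : fieldType) (W : vectType K) (e : (\dim {:W}).-tuple W).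
Hypothesis e_basis : basis_of fullv e.
Definition trace_in (f : 'End(W)) : K := \tr (mxof e e f).

Lemma trace_in_linear : linear (trace_in : 'End(W) -> K^o).
Proof. by move=> a f g; rewrite /trace_in linearP /= linearP. Qed.
HB.instance Definition _ :=
  GRing.isLinear.Build K 'End(W) K^o *:%R trace_in trace_in_linear.
Lemma trace_in_comp f g : trace_in (f \o g)%VF = trace_in (g \o f)%VF.
Proof. by rewrite /trace_in !(mxof_comp _ _ e_basis) mxtrace_mulC. Qed.

Lemma trace_in_sq (T : 'End(W)) (c : 'I_(\dim {:W}) -> K) :
  (forall i, T (tnth e i) = c i *: tnth e i) ->
  trace_in (T \o T)%VF = \sum_i c i ^+ 2.
Proof.
move=> Tc; apply: eq_bigr => i _.
rewrite !mxE /= vecof_delta -tnth_nth comp_lfunE !(Tc, linearZ) /=.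
rewrite Tc linearZ /= (tnth_nth 0) coord_free ?(basis_free e_basis) // eqxx.
by rewrite /= mulr1 expr2.
Qed.
End Trace.

(** * Integrality of the eigenvalues of an sl_2-triple *)

Section Sl2.
Variables (K : numFieldType) (W : vectType K).

(** All the a k would be eigenvalues of T, that is roots of one characteristic
polynomial, which has only finitely many. *)
Lemma eigen_chain (T : 'End(W)) (a : nat -> K) (u : nat -> W) :
  injective a -> (forall k, T (u k) = a k *: u k) -> exists k, u k = 0.
Proof.
move=> inja Tu; apply: contrapT => nu.
have u0 k : u k != 0 by apply/eqP => uk; apply: nu; exists k.
pose e := vbasis {:W}; have eb : basis_of fullv e := vbasisP _.
pose p := char_poly (mxof e e T).
have p0 : p != 0 by rewrite monic_neq0 // char_poly_monic.
have := @max_poly_roots _ p [seq a k | k <- iota 0 (size p)] p0.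
rewrite size_map size_iota ltnn map_inj_uniq ?iota_uniq // => h.
suff /h/(_ isT) : all (root p) [seq a k | k <- iota 0 (size p)] by [].
apply/allP => _ /mapP[k _ ->]; rewrite /p -eigenvalue_root_char.
apply/eigenvalueP; exists (rVof e (u k)).
  by rewrite -(rVof_app e eb) Tu linearZ.
by rewrite (rVof_eq0 eb) u0.
Qed.

Variables (X Y T : 'End(W)).
Hypotheses (TX : forall w, T (X w) = X (T w) + X w *+ 2)
  (TY : forall w, T (Y w) = Y (T w) - Y w *+ 2)
  (XY : forall w, X (Y w) = Y (X w) + T w).

Lemma sl2_X_iter a v k : T v = a *: v ->
  T (iter k X v) = (a + k%:R *+ 2) *: iter k X v.
Proof.
move=> Tv; elim: k => [|k IH] /=; first by rewrite mul0rn addr0.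
rewrite TX IH linearZ /= -scaler_nat -scalerDl; congr (_ *: _).
by rewrite -[k.+1]addn1 natrD; ring.
Qed.
Lemma sl2_Y_iter a v k : T v = a *: v ->
  T (iter k Y v) = (a - k%:R *+ 2) *: iter k Y v.
Proof.
move=> Tv; elim: k => [|k IH] /=; first by rewrite mul0rn subr0.
rewrite TY IH linearZ /= -scaler_nat -scalerBl; congr (_ *: _).
by rewrite -[k.+1]addn1 natrD; ring.
Qed.
Lemma sl2_XY_iter a v k : T v = a *: v -> X v = 0 ->
  X (iter k.+1 Y v) = (k.+1%:R * (a - k%:R)) *: iter k Y v.
Proof.
move=> Tv Xv; elim: k => [|k IH].
  by rewrite /= XY Xv linear0 add0r Tv mul1r subr0.
rewrite [iter k.+2 _ _]iterS XY IH linearZ /= -iterS (sl2_Y_iter k.+1 Tv) -scalerDl.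
by congr (_ *: _); rewrite -[k.+2]addn1 -[k.+1]addn1 !natrD; ring.
Qed.

(** Raise v to the last nonzero X^m v, of eigenvalue b = a + 2 m, then lower that to its
last nonzero image under Y^p.  As Y^(p+1) gives 0, applying X once more yields
(p + 1) (b - p) = 0, so a = p - 2 m. *)
Lemma sl2_int a v : v != 0 -> T v = a *: v -> exists z : int, a = z%:~R.
Proof.
move=> v0 Tv.
have inj_m2 (s : K) : s != 0 -> forall b, injective (fun k : nat => b + s * k%:R).
  by move=> s0 b i j /addrI /(mulfI s0) /eqP; rewrite eqr_nat => /eqP.
have two0 : (2 : K) != 0 by rewrite pnatr_eq0.
(* the last nonzero vector of a chain that reaches 0 *)
have first0 (Z : 'End(W)) (w : W) : w != 0 -> (exists k, iter k Z w = 0) ->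
    exists2 m, iter m Z w != 0 & Z (iter m Z w) = 0.
  move=> w0 [k0 hk0]; have exk : exists k, iter k Z w == 0 by exists k0; apply/eqP.
  case: (ex_minnP exk) => -[|m] /eqP hm mmin; first by move: hm w0 => /= ->; rewrite eqxx.
  by exists m => //; apply/negP => /mmin; rewrite ltnn.
have [m v'0 Xv'] : exists2 m, iter m X v != 0 & X (iter m X v) = 0.
  apply: first0 => //; apply: (eigen_chain (inj_m2 2 two0 a) (T := T)) => k.
  by rewrite (sl2_X_iter k Tv); congr (_ *: _); ring.
have Tv' := sl2_X_iter m Tv.
move: (iter m X v) v'0 Xv' Tv' => v' v'0 Xv' Tv'.
have [p w0 Yw] : exists2 p, iter p Y v' != 0 & Y (iter p Y v') = 0.
  have two0' : (-2 : K) != 0 by rewrite oppr_eq0.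
  apply: first0 => //; apply: (eigen_chain (inj_m2 _ two0' (a + m%:R *+ 2)) (T := T)) => k.
  by rewrite (sl2_Y_iter k Tv'); congr (_ *: _); ring.
have := sl2_XY_iter p Tv' Xv'; rewrite iterS Yw linear0 => /esym/eqP.
rewrite scaler_eq0 (negPf w0) orbF mulf_eq0 pnatr_eq0 /= subr_eq0 => /eqP e.
exists (p%:Z - (m%:Z) *+ 2); rewrite rmorphB rmorphMn /= -!pmulrn -e.
by rewrite addrK.
Qed.
End Sl2.

(** * Dual bases and the Casimir identity *)

Lemma linear_sumE (K : pzRingType) (U V : lmodType K) (f : U -> V) (lf : linear f)
  (I : Type) (r : seq I) (c : I -> K) (F : I -> U) :
  f (\sum_(i <- r) c i *: F i) = \sum_(i <- r) c i *: f (F i).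
Proof.
have f0 : f 0 = 0 by have := lf (-1) 0 0; rewrite scaleN1r oppr0 addr0 scaleN1r addNr.
by elim: r => [|i r IH]; rewrite ?big_nil // !big_cons lf IH.
Qed.

Definition lfun_of (K : fieldType) (U V : vectType K) (f : U -> V) (lf : linear f) :
  'Hom(U, V) :=
  let F : {linear U -> V} := HB.pack f (GRing.isLinear.Build K U V *:%R f lf) in
  linfun F.
Lemma lfun_ofE (K : fieldType) (U V : vectType K) (f : U -> V) (lf : linear f) u :
  lfun_of lf u = f u.
Proof. by rewrite lfunE. Qed.

Lemma free_subseq (K : fieldType) (W : vectType K) (s : seq W) :
  exists t, [/\ {subset t <= s}, free t & <<t>>%VS = <<s>>%VS].
Proof.
elim: s => [|v s [t [ts ft st]]]; first by exists [::]; rewrite nil_free.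
case: (boolP (v \in <<t>>%VS)) => vt.
  exists t; split=> //; first by move=> x /ts xs; rewrite inE xs orbT.
  by rewrite span_cons -st; apply/esym/addv_idPr; rewrite -memvE.
exists (v :: t); split; last by rewrite !span_cons st.
  by move=> x; rewrite !inE => /orP[->//|/ts ->]; rewrite orbT.
by rewrite free_cons vt ft.
Qed.

Section DualBasis.
Variables (K : fieldType) (g : vectType K) (B : g -> g -> K^o).
Hypotheses (Bl : forall y, linear (B^~ y)) (Br : forall x, linear (B x)).
Hypothesis (Bsym : forall x y, B x y = B y x).
Hypothesis (Bnd : forall x, (forall y, B x y = 0) -> x = 0).
Local Notation d := (\dim {:g}).
Local Notation e := (vbasis {:g}).

(** The dual basis is read off the inverse of the Gram matrix of B. *)
Lemma dual_basis : exists e' : 'I_d -> g,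
  [/\ forall i j : 'I_d, B e`_i (e' j) = (i == j)%:R,
      forall x, x = \sum_(i < d) B x (e' i) *: e`_i
    & forall x, x = \sum_(i < d) B e`_i x *: e' i].
Proof.
have eb : basis_of fullv e := vbasisP _.
have Bx0 x : (forall i : 'I_d, B x e`_i = 0) -> x = 0.
  move=> Bx; apply: Bnd => y.
  rewrite (coord_basis eb (memvf y)) (linear_sumE (Br x)) big1 // => i _.
  by rewrite Bx scaler0.
pose G := \matrix_(i, j) B e`_i e`_j : 'M[K]_d.
have Gu : G \in unitmx.
  rewrite -row_free_unit -kermx_eq0; apply/rowV0P => u /sub_kermxP uG.
  have : \sum_(i < d) u 0 i *: e`_i = 0.
    apply: Bx0 => j; rewrite (linear_sumE (Bl _)).
    have := congr1 (fun m : 'rV_d => m 0 j) uG; rewrite !mxE; apply: etrans.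
    by apply: eq_bigr => i _; rewrite !mxE.
  have /freeP fe := basis_free eb; move=> /fe u0.
  by apply/rowP => i; rewrite u0 mxE.
pose e' j := \sum_(k < d) invmx G k j *: e`_k.
have Be (i j : 'I_d) : B e`_i (e' j) = (i == j)%:R.
  rewrite (linear_sumE (Br _)).
  have /matrixP/(_ i j) := mulmxV Gu; rewrite !mxE; apply: etrans.
  by apply: eq_bigr => k _; rewrite !mxE mulrC.
exists e'; split=> //.
  move=> x; rewrite {1}(coord_basis eb (memvf x)); apply: eq_bigr => i _.
  congr (_ *: _); rewrite {2}(coord_basis eb (memvf x)) (linear_sumE (Bl _)).
  rewrite (bigD1 i) //= Be eqxx big1 ?addr0 => [|j ji]; first by rewrite /GRing.scale /= mulr1.
  by rewrite Be (negPf ji) scaler0.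
move=> x; apply/eqP; rewrite -subr_eq0; apply/eqP; apply: Bx0 => j.
rewrite Bsym -scaleN1r addrC Br (linear_sumE (Br _)) (bigD1 j) //= Be eqxx.
rewrite big1 ?addr0 => [|i ij]; last by rewrite Be eq_sym (negPf ij) scaler0.
by rewrite [_ *: 1]mulr1 scaleN1r addNr.
Qed.
End DualBasis.

Section Casimir.
Variables (K : fieldType) (g : lieVectType K) (B : g -> g -> K^o).
Hypothesis (Binv : forall x y z, B (lieb x y) z = - B y (lieb x z)).
Local Notation d := (\dim {:g}).
Local Notation e := (vbasis {:g}).
Variable e' : 'I_d -> g.
Hypotheses (De : forall x, x = \sum_(i < d) B x (e' i) *: e`_i)
           (De' : forall x, x = \sum_(i < d) B e`_i x *: e' i).

(** The tensor sum e_i (x) e'_i is g-invariant: expanding both brackets in the dual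
bases, the two double sums cancel term by term by invariance of the form. *)
Lemma casimir_inv (V : lmodType K) (b : g -> g -> V)
  (bl : forall y, linear (b^~ y)) (br : forall x, linear (b x)) x :
  \sum_(i < d) (b (lieb x e`_i) (e' i) + b e`_i (lieb x (e' i))) = 0.
Proof.
rewrite big_split /=.
under eq_bigr => i _ do rewrite [lieb x e`_i]De (linear_sumE (bl _)).
under [X in _ + X]eq_bigr => i _ do rewrite [lieb x (e' i)]De' (linear_sumE (br _)).
rewrite [X in _ + X]exchange_big /= -big_split /= big1 // => i _.
rewrite -big_split /= big1 // => j _.
by rewrite Binv scaleNr addNr.
Qed.
End Casimir.

(** * Whitehead's first lemma *)

Section Reps.
Variables (K : numClosedFieldType) (g : lieVectType K).

Record is_rep (W : vectType K) (rho : g -> 'End(W)) : Prop := IsRep {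
  rep_linear : linear rho;
  rep_lie : forall x y w, rho (lieb x y) w = rho x (rho y w) - rho y (rho x w) }.
Record is_cocycle (W : vectType K) (rho : g -> 'End(W)) (phi : g -> W) : Prop := IsCocycle {
  cocycle_linear : linear phi;
  cocycle_lie : forall x y, phi (lieb x y) = rho x (phi y) - rho y (phi x) }.
Definition rep_stable (W : vectType K) (rho : g -> 'End(W)) (U : {vspace W}) :=
  forall x u, u \in U -> rho x u \in U.

Hypothesis simple_g : lie_simple g.

Lemma simple_ideal (P : g -> Prop) :
  P 0 -> (forall a x y, P x -> P y -> P (a *: x + y)) ->
  (forall x y, P y -> P (lieb x y)) ->
  (exists2 z, P z & z != 0) -> forall x, P x.
Proof.
move=> P0 PD PL [z Pz z0] x; have [U UP] := pred_vspace P0 PD.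
have [|U0|Uf] := simple_g.2 U.
- by move=> u v /UP Pv; apply/UP/PL.
- by move/UP: Pz; rewrite U0 memv0 (negPf z0).
- by apply/UP; rewrite Uf memvf.
Qed.

Variables X Y T : g.
Hypotheses (TX : lieb T X = X *+ 2) (TY : lieb T Y = - (Y *+ 2)) (XY : lieb X Y = T).
Hypothesis T_neq0 : T != 0.
Variable b : seq g.
Hypotheses (b_basis : basis_of fullv b)
  (Tb : forall y, y \in b -> exists c : K, lieb T y = c *: y).

Section Irreducible.
Variables (W : vectType K) (rho : g -> 'End(W)).
Hypothesis rho_rep : is_rep rho.
Hypothesis rho_irr : forall U, rep_stable rho U -> U = 0%VS \/ U = fullv.

Lemma rep_lin_l w : linear (fun x => rho x w).
Proof. by move=> a x y; rewrite (rep_linear rho_rep) add_lfunE scale_lfunE. Qed.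

Lemma rep0 : rho 0 = 0.
Proof.
have := rep_linear rho_rep (-1) 0 0.
by rewrite scaleN1r oppr0 addr0 scaleN1r addNr.
Qed.

Lemma repZ a x : rho (a *: x) = a *: rho x.
Proof. by have := rep_linear rho_rep a x 0; rewrite rep0 !addr0. Qed.

Lemma repD x y : rho (x + y) = rho x + rho y.
Proof. by have := rep_linear rho_rep 1 x y; rewrite !scale1r. Qed.
Lemma repN x : rho (- x) = - rho x.
Proof. by rewrite -!scaleN1r repZ. Qed.

Lemma rep_ker : (exists2 z, rho z = 0 & z != 0) -> forall x, rho x = 0.
Proof.
apply: simple_ideal => [|a x y x0 y0|x y y0]; first exact: rep0.
  by rewrite (rep_linear rho_rep) x0 y0 scaler0 addr0.
by apply/lfunP => w; rewrite (rep_lie rho_rep) y0 !zero_lfunE linear0 subrr.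
Qed.

(** A root vector maps the eigenvectors of T to eigenvectors of T, and such vectors
span g; so the span of all eigenvectors of T is a submodule, nonzero because K is
algebraically closed. *)
Lemma irr_eigenbasis : {:W}%VS != 0%VS -> exists2 e : (\dim {:W}).-tuple W,
  basis_of fullv e & forall i, exists c, rho T (tnth e i) = c *: tnth e i.
Proof.
move=> W0; pose eig v := exists c, rho T v = c *: v.
pose P w := exists2 s : seq W, (forall v, v \in s -> eig v) & w \in <<s>>%VS.
have PD a x y : P x -> P y -> P (a *: x + y).
  move=> [s hs xs] [t ht yt]; exists (s ++ t).
    by move=> v; rewrite mem_cat => /orP[/hs|/ht].
  by rewrite span_cat memv_add // memvZ.
have P0 : P 0 by exists [::] => [v|]; rewrite ?in_nil ?mem0v.
have [U UP] := pred_vspace P0 PD.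
have U_stable : rep_stable rho U.
  move=> x w /UP[s hs ws].
  have xb : x \in <<b>>%VS by rewrite (span_basis b_basis) memvf.
  rewrite (coord_span (X := in_tuple b) xb) (linear_sumE (rep_lin_l w)).
  apply: memv_suml => i _; apply/memvZ/UP.
  have [d Td] := Tb (mem_nth 0 (ltn_ord i)); move: (in_tuple b)`_i Td => y Ty.
  exists [seq rho y v | v <- s].
    move=> _ /mapP[v /hs[c vc] ->]; exists (c + d).
    have := rep_lie rho_rep T y v; rewrite Ty vc repZ scale_lfunE linearZ /=.
    by move/eqP; rewrite eq_sym subr_eq => /eqP ->; rewrite -scalerDl addrC.
  by rewrite -limg_span memv_img.
have [U0|Uf] := rho_irr U_stable.
  have Wpos : (0 < \dim {:W})%N by rewrite lt0n dimv_eq0.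
  pose e := vbasis {:W}; have eb : basis_of fullv e := vbasisP _.
  have [a /eigenvalueP[v va v0]] := spectral.eigenvalue_closed (mxof e e (rho T)) Wpos.
  have : vecof e v \in U.
    apply/UP; exists [:: vecof e v]; last by rewrite memv_span // mem_head.
    move=> u; rewrite inE => /eqP ->; exists a.
    by rewrite (hom_vecof e eb) va linearZ.
  by rewrite U0 memv0 (vecof_eq0 eb) (negPf v0).
have [s hs sf] : exists2 s : seq W, (forall v, v \in s -> eig v) & <<s>>%VS = fullv.
  suff [s hs sv] : exists2 s, (forall v, v \in s -> eig v) &
      {subset tval (vbasis {:W}) <= <<s>>%VS}.
    exists s => //; apply/eqP; rewrite eqEsubv subvf /=.
    apply/subvP => v _; rewrite (coord_vbasis (memvf v)).
    by apply: memv_suml => i _; apply/memvZ/sv/mem_nth; rewrite size_tuple.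
  elim: (tval (vbasis {:W})) => [|w l [s hs sl]]; first by exists [::].
  have /UP[t ht wt] : w \in U by rewrite Uf memvf.
  exists (t ++ s) => [v|v]; first by rewrite mem_cat => /orP[/ht|/hs].
  rewrite span_cat inE => /orP[/eqP ->|/sl vs].
    exact: (subvP (addvSl _ _)).
  exact: (subvP (addvSr _ _)).
have [t [ts ft tf]] := free_subseq s; rewrite sf in tf.
have tb : basis_of fullv t by rewrite /basis_of tf eqxx.
have sz : size t == \dim {:W} by rewrite eq_sym -tf; have := ft; rewrite /free.
by exists (Tuple sz) => // i; apply/hs/ts/mem_tnth.
Qed.

(** The radical of the trace form is an ideal.  If it is all of g it contains T, and
the sum of the squares of the integer eigenvalues of T vanishes; then T acts by 0,
and so does the ideal that it generates. *)
Lemma irr_trace_nondeg (e : (\dim {:W}).-tuple W) : basis_of fullv e ->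
  (forall i, exists c, rho T (tnth e i) = c *: tnth e i) ->
  (exists x, rho x != 0) ->
  forall x, (forall y, trace_in e (rho x \o rho y)%VF = 0) -> x = 0.
Proof.
move=> eb eT [x0 rx0] x hx; apply: contrapT => /eqP xn0.
have radT : forall y, trace_in e (rho T \o rho y)%VF = 0.
  apply: (@simple_ideal (fun x => forall y, trace_in e (rho x \o rho y)%VF = 0)).
  - by move=> y; rewrite rep0 comp_lfun0l linear0.
  - move=> a u v hu hv y; rewrite (rep_linear rho_rep) comp_lfunDl -comp_lfunZl.
    by rewrite linearP /= hu hv scaler0 addr0.
  - move=> u v hv y.
    have -> : (rho (lieb u v) \o rho y =
       (rho u \o (rho v \o rho y)) - (rho v \o (rho u \o rho y)))%VF.
      apply/lfunP => w; rewrite !(comp_lfunE, add_lfunE, opp_lfunE).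
      exact: rep_lie rho_rep _ _ _.
    rewrite linearB /= (trace_in_comp eb) -comp_lfunA -linearB /=.
    have -> : ((rho v \o (rho y \o rho u)) - (rho v \o (rho u \o rho y)) =
       rho v \o rho (lieb y u))%VF.
      apply/lfunP => w; rewrite !(comp_lfunE, add_lfunE, opp_lfunE).
      by rewrite (rep_lie rho_rep) linearB.
    exact: hv.
  - by exists x.
suff rT : rho T = 0 by move: rx0; rewrite (rep_ker _ x0) ?eqxx //; exists T.
have [c Tc] : exists c : 'I_(\dim {:W}) -> K,
    forall i, rho T (tnth e i) = c i *: tnth e i.
  by exists (fun i => projT1 (cid (eT i))) => i; case: cid.
have cint i : exists z : int, c i = z%:~R.
  apply: (@sl2_int K W (rho X) (rho Y) (rho T) _ _ _ _ (tnth e i)) => //.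
  - move=> w; have := rep_lie rho_rep T X w; rewrite TX mulr2n repD add_lfunE.
    by rewrite -mulr2n => ->; rewrite addrC subrK.
  - move=> w; have := rep_lie rho_rep T Y w; rewrite TY mulr2n repN repD opp_lfunE.
    by rewrite add_lfunE -mulr2n => ->; rewrite addrC subrK.
  - by move=> w; have := rep_lie rho_rep X Y w; rewrite XY => ->; rewrite addrC subrK.
  - apply: (basis_not0 eb); exact: mem_tnth.
have c2ge0 i : 0 <= c i ^+ 2.
  by have [z ->] := cint i; rewrite -rmorphXn /= ler0z sqr_ge0.
have c0 i : c i = 0.
  have := radT T; rewrite (trace_in_sq eb Tc) => /eqP.
  rewrite psumr_eq0 // => /allP/(_ i (mem_index_enum i)).
  by rewrite sqrf_eq0 => /eqP.
apply/lfunP => w; rewrite (coord_basis eb (memvf w)) linear_sum zero_lfunE big1 // => i _.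
by rewrite linearZ /= -tnth_nth Tc c0 scale0r scaler0.
Qed.

(** On a trivial module a cocycle kills all brackets, hence g.  Otherwise the Casimir
operator C of the trace form is invertible, as its kernel is a submodule and its
trace is dim g, and sum e_i phi(e'_i) is a primitive of C o phi. *)
Lemma whitehead_irr (phi : g -> W) : is_cocycle rho phi ->
  exists w, forall x, phi x = rho x w.
Proof.
move=> [phi_lin phi_lie].
have [triv|/existsNP[x0 /eqP rx0]] := pselect (forall x, rho x = 0).
  exists 0 => x; rewrite linear0; apply: (@simple_ideal (fun x => phi x = 0)).
  - by have := phi_lin (-1) 0 0; rewrite scaleN1r oppr0 addr0 scaleN1r addNr.
  - by move=> a u v u0 v0; rewrite phi_lin u0 v0 scaler0 addr0.
  - by move=> u v v0; rewrite phi_lie !triv !zero_lfunE subrr.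
  - have [u [v uv]] := simple_g.1; exists (lieb u v); rewrite ?phi_lie ?triv ?zero_lfunE ?subrr //.
have W0 : {:W}%VS != 0%VS.
  apply: contra_neq rx0 => Wz; apply/lfunP => w.
  by have := memvf w; rewrite Wz memv0 => /eqP ->; rewrite !linear0.
have [e eb eT] := irr_eigenbasis W0.
pose B x y : K^o := trace_in e (rho x \o rho y)%VF.
have Bl y : linear (B^~ y).
  by move=> a u v; rewrite /B (rep_linear rho_rep) comp_lfunDl -comp_lfunZl linearP.
have Bsym x y : B x y = B y x by exact: trace_in_comp.
have Br x : linear (B x) by move=> a u v; rewrite ![B x _]Bsym; exact: Bl.
have Bnd x : (forall y, B x y = 0) -> x = 0.
  by apply: irr_trace_nondeg => //; exists x0.
have Binv x y z : B (lieb x y) z = - B y (lieb x z).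
  have split2 (F1 F2 F3 : 'End(W)) : (forall w, F1 w = F2 w - F3 w) ->
      trace_in e F1 = trace_in e F2 - trace_in e F3.
    by move=> FE; rewrite -linearB; congr trace_in; apply/lfunP => w;
       rewrite add_lfunE opp_lfunE.
  rewrite /B (split2 (rho (lieb x y) \o rho z)%VF (rho x \o (rho y \o rho z))%VF (rho y \o (rho x \o rho z))%VF).
    rewrite (split2 (rho y \o rho (lieb x z))%VF (rho y \o (rho x \o rho z))%VF ((rho y \o rho z) \o rho x)%VF).
      by rewrite (trace_in_comp eb (rho x)) opprB.
    by move=> w; rewrite !comp_lfunE (rep_lie rho_rep) linearB.
  by move=> w; rewrite !comp_lfunE (rep_lie rho_rep).
have [e' [Bee' De De']] := dual_basis Bl Br Bsym Bnd.
pose ei (i : 'I_(\dim {:g})) := (vbasis {:g})`_i.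
pose C := \sum_i (rho (ei i) \o rho (e' i))%VF.
have trC : trace_in e C = (\dim {:g})%:R.
  rewrite linear_sum /= (eq_bigr (fun=> 1)) ?sumr_const ?card_ord // => i _.
  by have := Bee' i i; rewrite eqxx.
have g0 : (\dim {:g} != 0)%N.
  rewrite dimv_eq0; apply: contra_neq T_neq0 => gz.
  by have := memvf T; rewrite gz memv0 => /eqP.
have CE w : C w = \sum_i rho (ei i) (rho (e' i) w).
  by rewrite sum_lfunE; apply: eq_bigr => i _; rewrite comp_lfunE.
have C_comm x w : rho x (C w) = C (rho x w).
  rewrite !CE linear_sum /=.
  apply/eqP; rewrite -subr_eq0 -sumrB; apply/eqP.
  have bl y : linear (fun u => rho u (rho y w)) by exact: rep_lin_l.
  have br u : linear (fun y => rho u (rho y w)).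
    by move=> a y z; rewrite rep_lin_l linearP.
  (* what is left is the invariance of the Casimir tensor *)
  rewrite -[RHS](casimir_inv Binv De De' bl br x); apply: eq_bigr => i _.
  by rewrite !(rep_lie rho_rep) linearB /= addrA subrK.
have C_inj : lker C == 0%VS.
  have C_stable : rep_stable rho (lker C).
    by move=> x w; rewrite !memv_ker -C_comm => /eqP ->; rewrite linear0.
  have [->//|kC] := rho_irr C_stable.
  have C0 : C = 0.
    apply/lfunP => w; rewrite zero_lfunE; apply/eqP.
    by rewrite -memv_ker kC memvf.
  by move: trC g0; rewrite C0 linear0 => /esym/eqP; rewrite pnatr_eq0 => ->.
pose w0 := \sum_i rho (ei i) (phi (e' i)).
have w0E x : rho x w0 = C (phi x).
  rewrite linear_sum /= CE; apply/eqP; rewrite -subr_eq0 -sumrB; apply/eqP.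
  have bl y : linear (fun u => rho u (phi y)) by exact: rep_lin_l.
  have br u : linear (fun y => rho u (phi y)).
    by move=> a y z; rewrite phi_lin linearP.
  rewrite -[RHS](casimir_inv Binv De De' bl br x); apply: eq_bigr => i _.
  by rewrite (rep_lie rho_rep) phi_lie linearB /= addrA subrK.
exists (C^-1%VF w0) => x.
apply: (lker0P C_inj); rewrite -C_comm -w0E; congr (rho x _).
by rewrite lker0_lfunVK.
Qed.
End Irreducible.

Section SubQuotient.
Variables (W : vectType K) (rho : g -> 'End(W)) (U : {vspace W}).
Hypotheses (rho_rep : is_rep rho) (U_stable : rep_stable rho U).

Definition vincl : 'Hom(subvs_of U, W) := linfun vsval.
Definition vretr : 'Hom(W, subvs_of U) := linfun (vsproj U).
Definition sub_rep (x : g) : 'End(subvs_of U) := (vretr \o rho x \o vincl)%VF.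

Lemma vinclE w : vincl w = vsval w. Proof. by rewrite lfunE. Qed.
Lemma vretrK w : w \in U -> vsval (vretr w) = w.
Proof. by move=> wU; rewrite lfunE /= vsprojK. Qed.
Lemma sub_repE x w : vsval (sub_rep x w) = rho x (vsval w).
Proof. by rewrite !comp_lfunE vinclE vretrK // U_stable ?subvsP. Qed.
Lemma sub_rep_rep : is_rep sub_rep.
Proof.
split=> [a x y|x y w]; last first.
  by apply: val_inj; rewrite /= !sub_repE (rep_lie rho_rep).
apply/lfunP => w; apply: val_inj.
by rewrite add_lfunE scale_lfunE /= !sub_repE (rep_lin_l rho_rep).
Qed.

(** The quotient W / U is realised on a complement C of U, with [quo_proj], the
projection onto C along U, in the role of the quotient map. *)
Let C := (U^C)%VS.
Let p := daddv_pi C U.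
Definition quo_proj : 'Hom(W, subvs_of C) := (linfun (vsproj C) \o p)%VF.
Definition quo_rep (x : g) : 'End(subvs_of C) := (quo_proj \o rho x \o linfun vsval)%VF.
Lemma quo_projE w : vsval (quo_proj w) = p w.
Proof. by rewrite comp_lfunE lfunE /= vsprojK // memv_pi. Qed.
Lemma quo_proj_sub w : w - vsval (quo_proj w) \in U.
Proof.
have dUC : (C :&: U = 0)%VS by rewrite capvC capv_compl.
have fUC : w \in (C + U)%VS by rewrite addvC addv_complf memvf.
rewrite quo_projE -{1}(daddv_pi_add dUC fUC) addrAC subrr add0r.
exact: memv_pi.
Qed.
Lemma quo_proj_ker u : u \in U -> quo_proj u = 0.
Proof.
move=> uU; apply: val_inj => /=.
have dUC : (U :&: C = 0)%VS by rewrite capv_compl.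
have : vsval (quo_proj u) \in (U :&: C)%VS.
  rewrite memv_cap subvsP andbT -(subKr u (vsval _)).
  by rewrite memvB // quo_proj_sub.
by rewrite dUC memv0 => /eqP.
Qed.
Lemma quo_repE x c : quo_rep x c = quo_proj (rho x (vsval c)).
Proof. by rewrite /quo_rep 2!comp_lfunE [linfun vsval c]lfunE. Qed.
Lemma quo_proj_rho x w : quo_rep x (quo_proj w) = quo_proj (rho x w).
Proof.
rewrite quo_repE.
apply/eqP; rewrite -subr_eq0 -!linearB /=; apply/eqP/quo_proj_ker.
by apply: U_stable; rewrite -opprB memvN quo_proj_sub.
Qed.
Lemma quo_proj_val c : quo_proj (vsval c) = c.
Proof.
apply: val_inj => /=; apply/eqP; rewrite eq_sym -subr_eq0.
have dUC : (U :&: C = 0)%VS by rewrite capv_compl.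
rewrite -memv0 -dUC memv_cap quo_proj_sub /=.
by rewrite memvB ?subvsP.
Qed.
Lemma quo_rep_rep : is_rep quo_rep.
Proof.
split=> [a x y|x y w].
  apply/lfunP => w; rewrite add_lfunE scale_lfunE -(quo_proj_val w) !quo_proj_rho.
  by rewrite (rep_lin_l rho_rep) linearP.
by rewrite -(quo_proj_val w) !quo_proj_rho (rep_lie rho_rep) linearB.
Qed.
End SubQuotient.

(** A submodule U allows to correct phi in two stages: by a primitive of its image in
W / U, after which phi takes values in U, and by a primitive there. *)
Theorem whitehead (W : vectType K) (rho : g -> 'End(W)) (phi : g -> W) :
  is_rep rho -> is_cocycle rho phi -> exists w, forall x, phi x = rho x w.
Proof.
have [d] := ubnP (\dim {:W}); elim: d => // d IH in W rho phi *.
rewrite ltnS => dW rho_rep phiC.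
have [irr|] := pselect (forall U, rep_stable rho U -> U = 0%VS \/ U = fullv).
  exact: whitehead_irr.
move=> /existsNP[U /not_implyP[U_st /not_orP[U0 Uf]]].
have dU : (\dim U < \dim {:W})%N.
  rewrite ltn_neqAle dimvS ?subvf // andbT; apply/eqP => dUf; apply: Uf.
  by apply/eqP; rewrite eqEdim subvf dUf leqnn.
have dU0 : (0 < \dim U)%N by rewrite lt0n dimv_eq0; apply/eqP.
have dsub (V : {vspace W}) : \dim {:subvs_of V} = \dim V by rewrite dimvf.
have [phi_lin phi_lie] := phiC.
have [w2 hw2] : exists w2, forall x, quo_proj U (phi x) = quo_rep rho U x w2.
  apply: IH; last first.
  - split=> [a x y|x y]; first by rewrite phi_lin linearP.
    by rewrite phi_lie linearB /= -!(quo_proj_rho U_st).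
  - exact: quo_rep_rep.
  - rewrite dsub dimv_compl; apply: leq_trans dW.
    by rewrite ltn_subrL dU0 (leq_trans dU0) // ltnW.
pose psi x := phi x - rho x (vsval w2).
have psiU x : psi x \in U.
  have := quo_proj_sub U (psi x); rewrite linearB /= hw2 -quo_proj_rho //.
  by rewrite quo_proj_val subrr subr0.
have [w1 hw1] : exists w1, forall x, vretr U (psi x) = sub_rep rho U x w1.
  apply: IH; last first.
  - split=> [a x y|x y].
      rewrite -linearP; congr (vretr U _); rewrite /psi phi_lin (rep_lin_l rho_rep).
      by rewrite scalerBr opprD addrACA.
    apply: val_inj; rewrite /= !sub_repE // !vretrK //.
    rewrite /psi phi_lie (rep_lie rho_rep).
    by rewrite !linearB /= !opprK addrACA.
  - exact: sub_rep_rep.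
  - by rewrite dsub; apply: leq_trans dU dW.
exists (vsval w1 + vsval w2) => x; rewrite linearD /=.
rewrite -(sub_repE U_st) -hw1 vretrK //.
by rewrite subrK.
Qed.

Corollary whitehead_sub (W : vectType K) (rho : g -> 'End(W)) (phi : g -> W)
  (U : {vspace W}) : is_rep rho -> is_cocycle rho phi -> rep_stable rho U ->
  (forall x, phi x \in U) -> exists2 w, w \in U & forall x, phi x = rho x w.
Proof.
move=> rho_rep [phi_lin phi_lie] U_st phiU.
have [w hw] : exists w, forall x, vretr U (phi x) = sub_rep rho U x w.
  apply: whitehead; first exact: sub_rep_rep.
  split=> [a x y|x y]; first by rewrite phi_lin linearP.
  by apply: val_inj; rewrite /= !sub_repE // !vretrK // phi_lie.
exists (vsval w); first exact: subvsP.
by move=> x; rewrite -(sub_repE U_st) -hw vretrK.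
Qed.
End Reps.

(** * Root spaces and weights *)

(** Commuting diagonalisable maps have a common eigenbasis; this transfers the fact
from matrices to endomorphisms. *)
Lemma eigenbasis_codiag (K : fieldType) (W : vectType K) (fs : seq 'End(W)) :
  (forall f k w, f \in fs -> k \in fs -> f (k w) = k (f w)) ->
  (forall f, f \in fs -> exists2 b : seq W, basis_of fullv b &
     forall y, y \in b -> exists c, f y = c *: y) ->
  exists2 e : (\dim {:W}).-tuple W, basis_of fullv e &
    forall f i, f \in fs -> exists c, f (tnth e i) = c *: tnth e i.
Proof.
move=> fs_comm fs_diag; pose v := vbasis {:W}.
have vb : basis_of fullv v := vbasisP _.
have [P Pu /allP hP] : codiagonalizable [seq mxof v v f | f <- fs].
  apply/codiagonalizableP; split=> [_ _ /mapP[f ff ->] /mapP[k kf ->]|_ /mapP[f ff ->]].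
    rewrite /comm_mx -!(mxof_comp _ _ vb); congr mxof; apply/lfunP => w.
    by rewrite !comp_lfunE fs_comm.
  have [b bb fb] := fs_diag f ff.
  have sb : size b = \dim {:W} by rewrite -(size_basis (X := in_tuple b) bb).
  pose P := \matrix_(i < \dim {:W}) rVof v b`_i.
  have PE u : u *m P = rVof v (\sum_(i < \dim {:W}) u 0 i *: b`_i).
    rewrite linear_sum mulmx_sum_row; apply: eq_bigr => i _.
    by rewrite linearZ /= rowK.
  have Pu : P \in unitmx.
    rewrite -row_free_unit -kermx_eq0; apply/rowV0P => u /sub_kermxP.
    rewrite PE => /eqP; rewrite (rVof_eq0 vb) => /eqP u0.
    have /freeP/(_ _ u0) ui : free (Tuple (introT eqP sb)) := basis_free bb.
    by apply/rowP => i; rewrite ui mxE.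
  exists P => //.
  have /fin_all_exists[c cE] (i : 'I_(\dim {:W})) : exists c, f b`_i = c *: b`_i.
    by apply/fb/mem_nth; rewrite sb.
  apply/diagonalizable_forPex; exists (\row_i c i).
  apply/(simmxP Pu)/row_matrixP => i; rewrite !row_mul rowK row_diag_mx -scalemxAl -rowE.
  by rewrite rowK -(rVof_app _ vb) cE linearZ mxE.
pose e := [tuple vecof v (row i P) | i < \dim {:W}].
exists e.
  rewrite basisEfree subvf size_tuple leqnn !andbT; apply/freeP => k.
  rewrite (eq_bigr (fun i => vecof v (k i *: row i P))); last first.
    by move=> i _; rewrite -tnth_nth tnth_mktuple linearZ.
  rewrite -linear_sum /= => /eqP; rewrite (vecof_eq0 vb).
  have -> : \sum_i k i *: row i P = (\row_i k i) *m P.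
    by rewrite mulmx_sum_row; apply: eq_bigr => i _; rewrite mxE.
  move=> /eqP /(congr1 (mulmx^~ (invmx P))); rewrite mul0mx mulmxK // => k0 i.
  by have := congr1 (fun m : 'rV_ _ => m 0 i) k0; rewrite !mxE.
move=> f i ff; have /diagonalizable_forPex[D /(simmxP Pu) PD] := hP _ (map_f _ ff).
exists (D 0 i); rewrite tnth_mktuple (hom_vecof v vb) -row_mul PD row_mul row_diag_mx.
by rewrite -scalemxAl -rowE linearZ.
Qed.

Section RootSpaces.
Variables (K : fieldType) (g : lieVectType K) (h : cartan g).

Lemma lieb_jac (x y z : g) : lieb x (lieb y z) = lieb (lieb x y) z + lieb y (lieb x z).
Proof.
have := lieb_jacobi x y z; rewrite (liebC z (lieb x y)) (liebC z x).
by rewrite -[- lieb x z]scaleN1r liebZr scaleN1r => /eqP; rewrite subr_eq0 subr_eq => /eqP.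
Qed.

(** The root space decomposition, as a basis of g made of root vectors; the root 0
is allowed and stands for the Cartan subalgebra. *)
Lemma root_basis : exists2 e : (\dim {:g}).-tuple g, basis_of fullv e &
  forall i, exists beta : hdual h, root_space beta (tnth e i).
Proof.
pose ad (x : g) : 'End(g) := lfun_of (lieb_linearr x).
pose v := vbasis {:sub_lie h}.
have inh (t : sub_lie h) : sub_incl t \in subalg_vs h by exact: subvsP.
have [|_ /mapP[t tv ->]|e eb eh] := @eigenbasis_codiag K g [seq ad (sub_incl t) | t <- v].
- move=> _ _ w /mapP[t _ ->] /mapP[t' _ ->]; rewrite !lfun_ofE lieb_jac.
  by rewrite (cartan_abelian (inh t) (inh t')) lieb0l add0r.
- have [b bb tb] := cartan_diag (inh t); exists b => // y /tb[c yc].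
  by exists c; rewrite lfun_ofE.
exists e => // i.
have e_i (t : sub_lie h) : exists c, lieb (sub_incl t) (tnth e i) = c *: tnth e i.
  rewrite (coord_vbasis (memvf t)).
  apply: (big_ind (fun t : sub_lie h => exists c, lieb (sub_incl t) (tnth e i) = c *: tnth e i)).
  - by exists 0; rewrite linear0 lieb0l scale0r.
  - by move=> x y [c xc] [d yd]; exists (c + d); rewrite linearD liebDl xc yd scalerDl.
  - move=> j _; have [|c vc] := eh (ad (sub_incl v`_j)) i.
      by apply/map_f/mem_nth; rewrite size_tuple.
    exists (coord v j t * c); rewrite linearZ liebZl.
    by move: vc; rewrite lfun_ofE => ->; rewrite scalerA.
have lin : linear (fun t : sub_lie h => coord e i (lieb (sub_incl t) (tnth e i)) : K^o).
  by move=> a x y; rewrite linearP liebDl liebZl linearP.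
exists (lfun_of lin) => t; rewrite lfun_ofE; have [c ->] := e_i t.
congr (_ *: _); rewrite linearZ /= (tnth_nth 0) coord_free ?(basis_free eb) // eqxx.
by rewrite [RHS]mulr1.
Qed.

Lemma root_space0 (x : g) : root_space (0 : hdual h) x -> exists t : sub_lie h, x = sub_incl t.
Proof.
move=> x0; have xh : x \in subalg_vs h.
  by apply: cartan_centralizer => y yh; have := x0 (Subvs yh); rewrite zero_lfunE scale0r.
by exists (Subvs xh).
Qed.

Section PositiveCone.
Variables (n : nat) (alpha : n.-tuple (hdual h)).

Lemma Qplus0 : Qplus alpha 0.
Proof. by exists (fun=> 0%N); rewrite big1. Qed.
Lemma QplusD mu nu : Qplus alpha mu -> Qplus alpha nu -> Qplus alpha (mu + nu).
Proof.
move=> [k ->] [l ->]; exists (fun i => k i + l i)%N.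
by rewrite -big_split; apply: eq_bigr => i _; rewrite mulrnDr.
Qed.
End PositiveCone.
End RootSpaces.

Section SimpleLieAlgebra.
Variables (K : numClosedFieldType) (g : lieVectType K) (h : cartan g).
Variables (n : nat) (alpha omega : n.-tuple (hdual h)).
Hypotheses (simple_g : lie_simple g) (simple_alpha : simple_roots alpha).
Hypothesis fund_omega : fundamental_weights alpha omega.

Lemma Qplus_anti mu : Qplus alpha mu -> Qplus alpha (- mu) -> mu = 0.
Proof.
have [/basis_free fa _ _] := simple_alpha.
move=> [k kE] [l lE]; rewrite kE big1 // => i _.
have /freeP/(_ (fun i => (k i + l i)%:R)) fi := fa.
have : (k i + l i)%:R = 0 :> K.
  apply: fi; rewrite -[RHS](subrr mu) {1}kE lE -big_split; apply: eq_bigr => j _.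
  by rewrite -tnth_nth scaler_nat mulrnDr.
by move=> /eqP; rewrite pnatr_eq0 addn_eq0 => /andP[/eqP -> _].
Qed.

(** Without simple roots there is no nonzero weight, so g is its own Cartan
subalgebra and is abelian. *)
Lemma rank_gt0 : (0 < n)%N.
Proof.
rewrite lt0n; apply/eqP => n0.
have mu0 (mu : hdual h) : mu = 0.
  have [/span_basis sa _ _] := simple_alpha; apply/eqP; rewrite -memv0.
  have := memvf mu; rewrite -sa; have: size alpha = 0%N by rewrite size_tuple n0.
  by move/size0nil => ->; rewrite span_nil.
have [e eb er] := root_basis h.
have inh (x : g) : x \in subalg_vs h.
  rewrite (coord_basis eb (memvf x)); apply: memv_suml => i _; apply: memvZ.
  have [beta] := er i; rewrite (mu0 beta) => /root_space0[t ti].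
  by rewrite -tnth_nth ti; exact: subvsP.
have [x [y]] := simple_g.1; case/eqP.
by apply: (cartan_abelian (c := h)).
Qed.

(** A simple coroot and its two root vectors form the sl_2-triple that Whitehead's
lemma requires. *)
Theorem whitehead_sub_cartan (W : vectType K) (rho : g -> 'End(W)) (phi : g -> W)
  (U : {vspace W}) : is_rep rho -> is_cocycle rho phi -> rep_stable rho U ->
  (forall x, phi x \in U) -> exists2 w, w \in U & forall x, phi x = rho x w.
Proof.
pose i0 := Ordinal rank_gt0.
have [t [at2 [x [y [hx hy xy]]]] _] := fund_omega i0 i0.
have tin : sub_incl t \in subalg_vs h by exact: subvsP.
have [b bb tb] := cartan_diag tin.
apply: (whitehead_sub simple_g (X := x) (Y := y) (T := sub_incl t) _ _ xy _ bb tb).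
- by rewrite hx at2 scaler_nat.
- by rewrite hy opp_lfunE at2 scaleNr scaler_nat.
- apply/eqP => t0; have tz : t = 0 by apply: subvs_inj.
  by move: at2; rewrite tz linear0 => /eqP; rewrite eq_sym pnatr_eq0.
Qed.
End SimpleLieAlgebra.

(** * Weights of modules over an enveloping algebra *)

Section EnvelopingAction.
Variables (K : fieldType) (g : lieAlgType K) (V : lmodType (uea g)).
Implicit Types (v : V) (c : K).

Lemma uactZ (u : uea g) c v : u *: (c%:A *: v) = c%:A *: (u *: v).
Proof. by rewrite !scalerA mulr_algl mulr_algr. Qed.
Lemma uact_lie x y v :
  ugen x *: (ugen y *: v) = ugen (lieb x y) *: v + ugen y *: (ugen x *: v).
Proof. by rewrite ugen_lie scalerBl !scalerA subrK. Qed.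
Lemma ugenZ_act c x v : ugen (c *: x) *: v = c%:A *: (ugen x *: v).
Proof. by rewrite linearZ scalerA mulr_algl. Qed.

End EnvelopingAction.

Section WeightSpaces.
Variables (K : fieldType) (g : lieVectType K) (h : cartan g) (V : lmodType (uea g)).
Implicit Types (v w : V) (c : K) (mu nu : hdual h).

Lemma weight_space_root (beta mu : hdual h) x v : root_space beta x ->
  weight_space mu v -> weight_space (mu + beta) (ugen x *: v).
Proof.
move=> hx hv t; rewrite uact_lie hx hv ugenZ_act uactZ -scalerDl -scalerDl.
by rewrite add_lfunE addrC.
Qed.
Lemma weight_spaceZ mu c v : weight_space mu v -> weight_space mu (c%:A *: v).
Proof. by move=> hv t; rewrite uactZ hv !scalerA -!scalerAl !mul1r !scalerA mulrC. Qed.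
Lemma weight_spaceD mu v w :
  weight_space mu v -> weight_space mu w -> weight_space mu (v + w).
Proof. by move=> hv hw t; rewrite !scalerDr hv hw. Qed.

(** Choose t at which mu differs from the weight of the first summand: t minus that
weight kills the summand, keeps the other weight spaces and multiplies v by a nonzero
scalar, so the number of summands can be lowered. *)
Lemma weight_indep mu v (s : seq (hdual h * V)) :
  (forall p, p \in s -> p.1 != mu /\ weight_space p.1 p.2) ->
  v = \sum_(p <- s) p.2 -> weight_space mu v -> v = 0.
Proof.
have [m] := ubnP (size s); elim: m => // m IH in s v *; rewrite ltnS.
case: s => [|[nu w] s] /= sm hs vE hv; first by rewrite vE big_nil.
have [/= numu hw] := hs _ (mem_head _ _).
have /lfunPn[t tmu] : nu != mu by [].
pose c := (mu t : K) - nu t.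
have c0 : c != 0 by rewrite subr_eq0 eq_sym.
have cvE : c%:A *: v = 0.
  pose f (p : hdual h * V) := (p.1, ((p.1 t : K) - nu t)%:A *: p.2).
  apply: (IH [seq f p | p <- s]); last exact: weight_spaceZ.
  - by rewrite size_map.
  - move=> _ /mapP[p ps ->] /=; have [pmu hp] := hs p (mem_behead (s := (nu, w) :: s) ps).
    by split=> //; exact: weight_spaceZ.
  have : ugen (sub_incl t) *: v - (nu t : K)%:A *: v = c%:A *: v.
    by rewrite hv -scalerBl -scalerBl.
  move=> <-; rewrite vE big_cons /= !scalerDr hw opprD addrACA subrr add0r.
  rewrite big_map !scaler_sumr -sumrB big_seq [RHS]big_seq; apply: eq_bigr => p ps /=.
  have [_ hp] := hs p (mem_behead (s := (nu, w) :: s) ps).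
  by rewrite hp -!scalerBl.
by rewrite -[v]scale1r -[1]scale1r -(mulVf c0) -scalerA -[_ *: _%:A]mulr_algl -scalerA cvE scaler0.
Qed.

Definition wsum (P : hdual h -> Prop) v := exists2 s : seq (hdual h * V),
  (forall p, p \in s -> P p.1 /\ weight_space p.1 p.2) & v = \sum_(p <- s) p.2.

Lemma wsum_weight (P : hdual h -> Prop) mu v :
  wsum P v -> ~ P mu -> weight_space mu v -> v = 0.
Proof.
move=> [s hs vE] Pmu; apply: (weight_indep (s := s)) => // p /hs[Pp hp].
by split=> //; apply/eqP => pmu; apply: Pmu; rewrite -pmu.
Qed.
Lemma wsum0 P : wsum P 0.
Proof. by exists [::] => [p|]; rewrite ?in_nil ?big_nil. Qed.
Lemma wsumD P v w : wsum P v -> wsum P w -> wsum P (v + w).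
Proof.
move=> [s hs ->] [t ht ->]; exists (s ++ t); last by rewrite big_cat.
by move=> p; rewrite mem_cat => /orP[/hs|/ht].
Qed.
Lemma wsum1 (P : hdual h -> Prop) mu v : P mu -> weight_space mu v -> wsum P v.
Proof.
move=> Pmu hv; exists [:: (mu, v)]; last by rewrite big_seq1.
by move=> p; rewrite inE => /eqP ->.
Qed.
End WeightSpaces.

Lemma wsum_map (K : fieldType) (g : lieVectType K) (h : cartan g)
  (V V' : lmodType (uea g)) (P P' : hdual h -> Prop) (F : V -> V') :
  {morph F : x y / x + y} -> F 0 = 0 ->
  (forall mu v, P mu -> weight_space mu v -> wsum P' (F v)) ->
  forall v, wsum P v -> wsum P' (F v).
Proof.
move=> FD F0 FP v [s hs ->]; rewrite (big_morph F FD F0) big_seq.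
apply: big_ind => [|x y|p ps]; [exact: wsum0|exact: wsumD|].
by have [Pp hp] := hs p ps; exact: FP hp.
Qed.

Lemma wsumZ (K : fieldType) (g : lieVectType K) (h : cartan g) (V : lmodType (uea g))
  (P : hdual h -> Prop) a (v : V) : wsum P v -> wsum P (a%:A *: v).
Proof.
apply: (wsum_map (F := fun v => a%:A *: v)) => [v1 v2||mu v1 Pmu hv1].
- by rewrite scalerDr.
- by rewrite scaler0.
- by apply: (wsum1 Pmu); exact: weight_spaceZ.
Qed.

(** * Cyclic modules on a highest weight vector *)

Section HighestWeight.
Variables (K : numClosedFieldType) (g : lieVectType K) (h : cartan g).
Variables (n : nat) (alpha : n.-tuple (hdual h)).
Hypothesis simple_alpha : simple_roots alpha.
Variables (V : lmodType (uea g)) (lambda : hdual h) (u : V).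
Hypotheses (u_weight : weight_space lambda u)
  (u_highest : forall beta x, is_root beta -> Qplus alpha beta ->
    root_space beta x -> ugen x *: u = 0).

(** The subspace U(n^-) u, without the Poincare-Birkhoff-Witt theorem. *)
Inductive neg_span : V -> Prop :=
| neg_span_gen c : neg_span (c%:A *: u)
| neg_spanD v w : neg_span v -> neg_span w -> neg_span (v + w)
| neg_span_root beta x v : is_root beta -> Qplus alpha (- beta) ->
    root_space beta x -> neg_span v -> neg_span (ugen x *: v).

Lemma neg_span0 : neg_span 0.
Proof. by rewrite -(scale0r u) -(scale0r 1); exact: neg_span_gen. Qed.
Lemma neg_spanZ c v : neg_span v -> neg_span (c%:A *: v).
Proof.
elim=> {v} [a|v w _ hv _ hw|beta x v hb hq hx _ hv].
- by rewrite scalerA -scalerAl mul1r scalerA; exact: neg_span_gen.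
- by rewrite scalerDr; exact: neg_spanD.
- by rewrite -uactZ; exact: neg_span_root hx hv.
Qed.

(** Induction on the number of negative root vectors: y x v = [y, x] v + x (y v). *)
Lemma neg_span_ugen v : neg_span v -> forall x, neg_span (ugen x *: v).
Proof.
elim=> {v} [c|v w _ hv _ hw|beta x v hb hq hx _ hv] y.
- rewrite uactZ; apply: neg_spanZ.
  have [e eb er] := root_basis h.
  rewrite (coord_basis eb (memvf y)) linear_sum scaler_suml.
  apply: big_ind => [||i _]; [exact: neg_span0|exact: neg_spanD|].
  rewrite ugenZ_act; apply: neg_spanZ; rewrite -tnth_nth.
  have [beta bi] := er i; have [b0|b0] := eqVneq beta 0.
    have [t ->] := root_space0 (h := h) (x := tnth e i) (eq_ind _ (fun b => root_space b _) bi _ b0).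
    by rewrite u_weight; exact: neg_span_gen.
  have [i0|i0] := eqVneq (tnth e i) 0.
    by rewrite i0 linear0 scale0r; exact: neg_span0.
  have rb : is_root beta by split=> //; exists (tnth e i).
  have [_ _ /(_ _ rb)[qb|qb]] := simple_alpha.
    by rewrite (u_highest rb qb bi); exact: neg_span0.
  rewrite -[u]scale1r -[1]scale1r; exact: neg_span_root rb qb bi (neg_span_gen _).
- by rewrite scalerDr; exact: neg_spanD.
- rewrite uact_lie; apply: neg_spanD; first exact: hv.
  exact: neg_span_root hx (hv y).
Qed.

Lemma neg_span_uea (x : uea g) : neg_span (x *: u).
Proof.
have : neg_span u by rewrite -[u]scale1r -[1]scale1r; exact: neg_span_gen.
elim/uea_ind: x u => [y|a|x y hx hy|x y hx hy] v hv.
- exact: neg_span_ugen.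
- exact: neg_spanZ.
- by rewrite scalerDl; apply: neg_spanD; [exact: hx|exact: hy].
- by rewrite -scalerA; apply: hx; exact: hy.
Qed.

Let lower nu := nu != lambda /\ wle alpha nu lambda.

Lemma neg_span_lower v : neg_span v ->
  exists c, exists2 w, wsum lower w & v = c%:A *: u + w.
Proof.
elim=> {v} [c|_ _ _ [c [v hv ->]] _ [d [w hw ->]]|beta x _ hb hq hx _ [c [v hv ->]]].
- by exists c, 0; rewrite ?addr0 //; exact: wsum0.
- exists (c + d), (v + w); first exact: wsumD.
  by rewrite !scalerDl addrACA.
exists 0, (ugen x *: (c%:A *: u + v)); last by rewrite !scale0r add0r.
have b0 : beta != 0 by have [] := hb.
have low nu : wle alpha nu lambda -> lower (nu + beta).
  move=> nl; have q : Qplus alpha (lambda - nu - beta) by exact: QplusD.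
  split; last by rewrite /wle opprD addrA.
  apply: contraNneq b0 => nbl; rewrite -oppr_eq0; apply/eqP.
  apply: (Qplus_anti simple_alpha hq); rewrite opprK.
  by move: nl; rewrite /wle -nbl addrAC subrr add0r.
rewrite scalerDr; apply: wsumD.
  apply: (@wsum1 _ _ _ _ _ (lambda + beta)).
    by apply: low; rewrite /wle subrr; exact: Qplus0.
  exact: weight_space_root (weight_spaceZ _ u_weight).
apply: (wsum_map _ _ _ hv) => [v1 v2||nu w [_ nl] hw].
- by rewrite scalerDr.
- by rewrite scaler0.
- exact: (wsum1 (low _ nl) (weight_space_root hx hw)).
Qed.

(** In U(n^-) u every vector is a multiple of u plus vectors of strictly lower weights. *)
Lemma hw_top (x : uea g) : weight_space lambda (x *: u) -> exists c, x *: u = c%:A *: u.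
Proof.
have [c [w hw xu]] := neg_span_lower (neg_span_uea x).
move=> hx; exists c; rewrite xu (wsum_weight (mu := lambda) hw) ?addr0 //.
  by case; rewrite eqxx.
have -> : w = x *: u + (- c)%:A *: u by rewrite xu !scaleNr addrC addKr.
by apply: weight_spaceD => //; exact: weight_spaceZ.
Qed.
End HighestWeight.

(** * Extending a highest weight vector to a map from V(lambda) *)

Section FiniteDimensionalModels.
Variables (K : numClosedFieldType) (g : lieVectType K).

Section InSpan.
Variables (V : lmodType (uea g)) (s : seq V).
Lemma in_spanD v w : in_span s v -> in_span s w -> in_span s (v + w).
Proof.
move=> [c ->] [d ->]; exists (fun i => c i + d i).
by rewrite -big_split; apply: eq_bigr => i _; rewrite !scalerDl.
Qed.
Lemma in_spanZ a v : in_span s v -> in_span s (a%:A *: v).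
Proof.
move=> [c ->]; exists (fun i => a * c i).
by rewrite scaler_sumr; apply: eq_bigr => i _; rewrite scalerA -scalerAl mul1r scalerA.
Qed.
Lemma in_span_sum (I : finType) (F : I -> V) :
  (forall i, in_span s (F i)) -> in_span s (\sum_i F i).
Proof.
move=> hF; apply: big_ind => [|v w|i _] //; last exact: in_spanD.
by exists (fun=> 0); rewrite big1 // => i _; rewrite !scale0r.
Qed.
Lemma mem_in_span v : v \in s -> in_span s v.
Proof.
move=> vs; have vi : (index v s < size s)%N by rewrite index_mem.
exists (fun i => (i == Ordinal vi)%:R); rewrite (bigD1 (Ordinal vi)) //= eqxx.
by rewrite !scale1r nth_index // big1 ?addr0 // => i /negPf ->; rewrite !scale0r.
Qed.
Lemma in_span_ugen x : (forall w, w \in s -> in_span s (ugen x *: w)) ->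
  forall w, in_span s w -> in_span s (ugen x *: w).
Proof.
move=> hs w [c ->]; rewrite scaler_sumr; apply: in_span_sum => i.
by rewrite uactZ; apply/in_spanZ/hs/mem_nth.
Qed.
Lemma in_span_uea : (forall x w, in_span s w -> in_span s (ugen x *: w)) ->
  forall (x : uea g) w, in_span s w -> in_span s (x *: w).
Proof.
move=> hs x; elim/uea_ind: x => [y|a|x y hx hy|x y hx hy] w hw.
- exact: hs.
- exact: in_spanZ.
- by rewrite scalerDl; apply: in_spanD; [exact: hx|exact: hy].
- by rewrite -scalerA; apply: hx; exact: hy.
Qed.
End InSpan.

Lemma in_span_trans (V : lmodType (uea g)) (s t : seq V) v :
  (forall w, w \in s -> in_span t w) -> in_span s v -> in_span t v.
Proof.
move=> hst [c ->]; apply: in_span_sum => i.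
by apply/in_spanZ/hst/mem_nth.
Qed.

(** Represents the g-stable subset P of a U(g)-module by a vector space with a
dimension, on which traces and Whitehead's lemma make sense. *)
Record rep_model (V : lmodType (uea g)) (P : V -> Prop) := RepModel {
  model_sort : vectType K;
  model_act : g -> 'End(model_sort);
  model_val : model_sort -> V;
  model_rep : is_rep model_act;
  model_linear : forall a w w',
    model_val (a *: w + w') = a%:A *: model_val w + model_val w';
  model_inj : injective model_val;
  model_actE : forall x w, model_val (model_act x w) = ugen x *: model_val w;
  model_image : forall v, P v <-> exists w, v = model_val w }.

(** Take row vectors of coefficients, modulo the relations between the members of s;
a complement of the relations serves as the quotient. *)
Lemma span_model (V : lmodType (uea g)) (s : seq V) :
  (forall x w, in_span s w -> in_span s (ugen x *: w)) ->
  inhabited (rep_model (in_span s)).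
Proof.
move=> hs; set d := size s.
pose val0 (c : 'rV[K]_d) := \sum_(i < d) (c 0 i)%:A *: s`_i.
have val0_lin a c c' : val0 (a *: c + c') = a%:A *: val0 c + val0 c'.
  rewrite scaler_sumr -big_split; apply: eq_bigr => i _.
  by rewrite !mxE scalerDl scalerDl scalerA -scalerAl mul1r scalerA.
have val00 : val0 0 = 0 by rewrite /val0 big1 // => i _; rewrite mxE !scale0r.
have [N NP] : exists N : {vspace 'rV[K]_d}, forall c, c \in N <-> val0 c = 0.
  apply: (@pred_vspace K _ (fun c => val0 c = 0)) => // a c c' c0 c'0.
  by rewrite val0_lin c0 c'0 scaler0 addr0.
pose W := subvs_of (N^C)%VS; pose val (w : W) := val0 (vsval w).
have val_lin a w w' : val (a *: w + w') = a%:A *: val w + val w'.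
  by rewrite /val linearP val0_lin.
have val_inj : injective val.
  move=> w w' ww'; apply/eqP; rewrite -subr_eq0 -(inj_eq (@subvs_inj _ _ _)) linear0.
  rewrite -memv0 -(capv_compl N) memv_cap subvsP andbT; apply/NP.
  have -> : vsval (w - w') = -1 *: vsval w' + vsval w by rewrite linearB scaleN1r addrC.
  by rewrite val0_lin -/(val _) -/(val w) -ww' !scaleN1r addNr.
have val_im v : in_span s v <-> exists w, v = val w.
  split=> [[c ->]|[w ->]]; last by exists (fun i => vsval w 0 i).
  pose c' := \row_i c i; pose w := c' - projv N c'.
  exists (Subvs (memv_projC N c')); rewrite /val /=.
  have -> : c' - projv N c' = -1 *: projv N c' + c' by rewrite scaleN1r addrC.
  have pN : val0 (projv N c') = 0 by apply/NP; exact: memv_proj.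
  by rewrite val0_lin pN scaler0 add0r; apply: eq_bigr => i _; rewrite mxE.
have act_ex x w : exists w', val w' = ugen x *: val w.
  by have [|w' ->] := (val_im (ugen x *: val w)).1; [apply/hs/val_im; exists w|exists w'].
pose act x w := projT1 (cid (act_ex x w)).
have actE x w : val (act x w) = ugen x *: val w by rewrite /act; case: cid.
have act_lin x : linear (act x).
  by move=> a w w'; apply: val_inj; rewrite val_lin !actE val_lin scalerDr uactZ.
exists; apply: (@RepModel V _ W (fun x => lfun_of (act_lin x)) val) => //.
- split=> [a x y|x y w].
    apply/lfunP => w; rewrite add_lfunE scale_lfunE !lfun_ofE; apply: val_inj.
    by rewrite val_lin !actE linearD scalerDl ugenZ_act.
  rewrite !lfun_ofE; apply: val_inj.
  rewrite -[_ - _]addrC -scaleN1r val_lin !actE ugen_lie scalerBl -!scalerA.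
  by rewrite !scaleN1r addrC.
- by move=> x w; rewrite lfun_ofE actE.
Qed.
End FiniteDimensionalModels.

Section HighestWeightMaps.
Variables (K : numClosedFieldType) (g : lieVectType K) (h : cartan g).
Variables (n : nat) (alpha omega : n.-tuple (hdual h)).
Hypotheses (simple_g : lie_simple g) (simple_alpha : simple_roots alpha).
Hypothesis fund_omega : fundamental_weights alpha omega.
Variables (lambda : hdual h) (Vl : hw_irrep alpha lambda).

Lemma linear_equivariant (V V' : lmodType (uea g)) (F : V -> V') :
  (forall a v w, F (a%:A *: v + w) = a%:A *: F v + F w) ->
  (forall x v, F (ugen x *: v) = ugen x *: F v) -> linear F.
Proof.
move=> Flin Fgen; have FD v w : F (v + w) = F v + F w.
  by have := Flin 1 v w; rewrite !scale1r.
have F0 : F 0 = 0 by apply: (addrI (F 0)); rewrite -FD !addr0.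
move=> x v w; rewrite FD; congr (_ + _).
elim/uea_ind: x v {w} => [x|a|x y hx hy|x y hx hy] v //.
- by have := Flin a v 0; rewrite F0 !addr0.
- by rewrite !scalerDl FD hx hy.
- by rewrite -!scalerA hx hy.
Qed.

(** D is the graph-like submodule generated by (v_lambda, v), s0 a linear section of
its projection to V(lambda), and U the space of maps from V(lambda) to the kernel of
that projection.  The defect of s0 is a cocycle with values in U; removing a
primitive turns s0 into a g-map f0 whose graph still lies in D. *)
Lemma hw_hom (V : lmodType (uea g)) (v : V) : locally_finite_dim V ->
  weight_space lambda v ->
  (forall beta x, is_root beta -> Qplus alpha beta ->
    root_space beta x -> ugen x *: v = 0) ->
  exists f : {linear Vl -> V}, f (hwv Vl) = v.
Proof.
move=> lfV v_weight v_highest.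
have [s1 s1_all] := irrep_fin_dim Vl.
have [s2 [vs2 s2_st]] := lfV v.
have [[W1 r1 p1 r1_rep p1_lin p1_inj p1E p1_im]] := span_model (fun x w _ => s1_all (ugen x *: w)).
have [[W2 r2 p2 r2_rep p2_lin p2_inj p2E p2_im]] := span_model s2_st.
pose D w1 w2 := exists x : uea g, p1 w1 = x *: hwv Vl /\ p2 w2 = x *: v.
have D_lin a w1 w2 w1' w2' : D w1 w2 -> D w1' w2' -> D (a *: w1 + w1') (a *: w2 + w2').
  move=> [x [x1 x2]] [y [y1 y2]]; exists (a%:A * x + y).
  by rewrite p1_lin p2_lin x1 x2 y1 y2 !scalerDl !scalerA.
have p10 : p1 0 = 0 by have := p1_lin (-1) 0 0; rewrite !scaleN1r oppr0 addr0 addNr.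
have p20 : p2 0 = 0 by have := p2_lin (-1) 0 0; rewrite !scaleN1r oppr0 addr0 addNr.
have D0 : D 0 0 by exists 0; rewrite p10 p20 !scale0r.
have D_act y w1 w2 : D w1 w2 -> D (r1 y w1) (r2 y w2).
  move=> [x [x1 x2]]; exists (ugen y * x).
  by rewrite p1E p2E x1 x2 !scalerA.
have D_total w1 : exists w2, D w1 w2.
  have [x xE] := irrep_cyclic (p1 w1).
  have [|w2 w2E] := (p2_im (x *: v)).1; first exact: in_span_uea.
  by exists w2, x.
have [s0 Ds0] : exists s0 : 'Hom(W1, W2), forall w, D w (s0 w).
  have /fin_all_exists[f0 Df0] (i : 'I_(\dim {:W1})) := D_total (vbasis {:W1})`_i.
  have lin : linear (fun w => \sum_i coord (vbasis {:W1}) i w *: f0 i).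
    move=> a w w'; rewrite scaler_sumr -big_split; apply: eq_bigr => i _.
    by rewrite linearP scalerDl scalerA.
  exists (lfun_of lin) => w; rewrite lfun_ofE {1}(coord_vbasis (memvf w)).
  apply: (big_ind2 D) => // [a1 a2 b1 b2 ha hb|i _].
    by have := D_lin 1 _ _ _ _ ha hb; rewrite !scale1r.
  by have := D_lin (coord (vbasis {:W1}) i w) _ _ _ _ (Df0 i) D0; rewrite !addr0.
pose rF0 x (m : 'Hom(W1, W2)) := (r2 x \o m)%VF - (m \o r1 x)%VF.
have rF0_lin x : linear (rF0 x).
  move=> a m m'; apply/lfunP => w.
  rewrite !(add_lfunE, opp_lfunE, comp_lfunE, scale_lfunE) linearP.
  by rewrite scalerBr opprD addrACA.
pose rF x : 'End('Hom(W1, W2)) := lfun_of (rF0_lin x).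
have rFE x (m : 'Hom(W1, W2)) w : rF x m w = r2 x (m w) - m (r1 x w).
  by rewrite lfun_ofE add_lfunE opp_lfunE !comp_lfunE.
have rF_rep : is_rep rF.
  split=> [a x y|x y m]; first apply/lfunP => m; apply/lfunP => w.
    rewrite !(add_lfunE, scale_lfunE) !rFE (rep_linear r1_rep) (rep_linear r2_rep).
    by rewrite !(add_lfunE, scale_lfunE) linearP scalerBr opprD addrACA.
  rewrite !(add_lfunE, opp_lfunE) !rFE (rep_lie r1_rep) (rep_lie r2_rep).
  have abel (a b c d p q : W2) : a - b - (c - d) = a - p - (q - d) - (b - q - (p - c)).
    rewrite !opprB [RHS]addrACA (addrA (a - p)) subrK (addrA (d - q)) subrK.
    by rewrite [LHS]addrACA [RHS]addrACA [- c - b]addrC.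
  by rewrite !(linearB (r2 _)) (linearB m); apply: abel.
have [U UP] : exists U : {vspace 'Hom(W1, W2)}, forall m : 'Hom(W1, W2),
    m \in U <-> forall w, D 0 (m w).
  apply: (@pred_vspace K 'Hom(W1, W2) (fun m => forall w, D 0 (m w))) => [w|a m m' hm hm' w].
    by rewrite zero_lfunE.
  rewrite add_lfunE scale_lfunE.
  by have := D_lin a _ _ _ _ (hm w) (hm' w); rewrite scaler0 addr0.
have D_sub w w1 w2 : D w w1 -> D w w2 -> D 0 (w1 - w2).
  by move=> h1 h2; have := D_lin (-1) _ _ _ _ h2 h1; rewrite !scaleN1r addNr [- _ + _]addrC.
have U_st : rep_stable rF U.
  move=> x m /UP hm; apply/UP => w; rewrite rFE; apply: D_sub (hm _).
  by have := D_act x _ _ (hm w); rewrite linear0.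
have [m /UP hm s0m] : exists2 m, m \in U & forall x, rF x s0 = rF x m.
  apply: (whitehead_sub_cartan simple_g simple_alpha fund_omega rF_rep _ U_st) => [|x].
    split=> [a x y|x y]; first by rewrite (rep_linear rF_rep) add_lfunE scale_lfunE.
    by rewrite (rep_lie rF_rep).
  by apply/UP => w; rewrite rFE; apply: D_sub (D_act x _ _ (Ds0 w)) (Ds0 _).
pose f0 := s0 - m.
have f0E x w : f0 (r1 x w) = r2 x (f0 w).
  have : rF x f0 = 0 by rewrite linearB /= s0m subrr.
  by move/lfunP/(_ w); rewrite rFE zero_lfunE => /eqP; rewrite subr_eq0 => /eqP.
have Df0 w : D w (f0 w).
  rewrite add_lfunE opp_lfunE.
  by have := D_lin (-1) _ _ _ _ (hm w) (Ds0 w); rewrite scaler0 add0r scaleN1r addrC.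
have p1_onto w : exists a, w = p1 a by apply/p1_im/s1_all.
have [a1 a1E] := p1_onto (hwv Vl).
have f0a1 : p2 (f0 a1) = v.
  have [x [x1 x2]] := Df0 a1.
  (* (v_lambda, f0 v_lambda) is a vector of weight lambda in the cyclic module D *)
  pose P : lmodType (uea g) := (irrep_mod Vl * V)%type.
  pose u : P := (hwv Vl, v).
  have u_weight : weight_space lambda u.
    by move=> t; congr pair; [exact: hwv_weight|exact: v_weight].
  have u_highest beta y : is_root beta -> Qplus alpha beta ->
      root_space beta y -> ugen y *: u = 0.
    by move=> rb qb yb; congr pair; [exact: hwv_highest yb|exact: v_highest yb].
  have [|c] := hw_top simple_alpha u_weight u_highest (x := x).
    have -> : x *: u = (hwv Vl, p2 (f0 a1)) by rewrite a1E x1 x2.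
    move=> t; congr pair; first exact: hwv_weight.
    rewrite /= -p2E -f0E.
    have -> : r1 (sub_incl t) a1 = (lambda t : K) *: a1 + 0.
      by apply: p1_inj; rewrite p1E p1_lin p10 addr0 -a1E hwv_weight.
    by rewrite linearP /= linear0 p2_lin p20 addr0.
  move=> [xc1 xc2]; rewrite x2 xc2.
  suff -> : c = 1 by rewrite !scale1r.
  apply/eqP; rewrite -subr_eq0; apply: contraT => c0.
  have : (c - 1)%:A *: hwv Vl = 0 by rewrite scalerBl scalerBl -xc1 -x1 -a1E !scale1r subrr.
  move/(congr1 (fun w => ((c - 1)^-1)%:A *: w)); rewrite scaler0 scalerA -scalerAl mul1r.
  by rewrite scalerA mulVf // !scale1r => /eqP; rewrite (negPf (hwv_neq0 Vl)).
pose inv w := projT1 (cid (p1_onto w)).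
have invE w : p1 (inv w) = w by rewrite /inv; case: cid.
pose F w := p2 (f0 (inv w)).
have F_lin : linear F.
  apply: linear_equivariant => [a w w'|x w]; rewrite /F.
    rewrite -p2_lin -linearP; congr (p2 (f0 _)); apply: p1_inj.
    by rewrite p1_lin !invE.
  by rewrite -p2E -f0E; congr (p2 (f0 _)); apply: p1_inj; rewrite p1E !invE.
exists (HB.pack_for {linear Vl -> V} F (GRing.isLinear.Build _ _ _ _ F F_lin)).
by rewrite /= /F -f0a1; congr (p2 (f0 _)); apply: p1_inj; rewrite invE.
Qed.
End HighestWeightMaps.

(** * Weights and local finiteness of modules over g (x) A *)

Section CurrentModules.
Variables (K : numClosedFieldType) (g : lieVectType K) (h : cartan g) (A : comAlgType K).
Local Notation UgA := (uea (current g A)).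

Lemma gmod_ugen (V : lmodType UgA) x (v : V) :
  ugen x *: (v : gmod V) = ugen (cur x 1) *: v :> V.
Proof. by rewrite -[LHS]/(uincl g A (ugen x) *: v) uea_map_gen. Qed.
Lemma gmodZ (V : lmodType UgA) (a : K) (v : V) : a%:A *: (v : gmod V) = a%:A *: v :> V.
Proof. by rewrite -[LHS]/(uincl g A a%:A *: v) rmorph_alg. Qed.

Lemma linear_gmod (V V' : lmodType UgA) (F : {linear V -> V'}) (x : uea g) (v : gmod V) :
  F (x *: v) = x *: (F v : gmod V').
Proof. exact: linearZ. Qed.

Section OneModule.
Variable V : lmodType UgA.
Implicit Types (v w : V).

Lemma cweight_root (beta mu : hdual h) x a v : root_space beta x ->
  cweight mu v -> cweight (mu + beta) (ugen (cur x a) *: v).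
Proof.
move=> hx hv t; rewrite gmod_ugen gmodZ uact_lie lieb_cur hx mul1r curZl.
rewrite ugenZ_act -gmod_ugen hv gmodZ uactZ -scalerDl -scalerDl.
by rewrite add_lfunE addrC.
Qed.

Lemma uea_closed (P : V -> Prop) : (forall v w, P v -> P w -> P (v + w)) ->
  (forall (a : K) v, P v -> P (a%:A *: v)) ->
  (forall x a v, P v -> P (ugen (cur x a) *: v)) ->
  forall (u : UgA) v, P v -> P (u *: v).
Proof.
move=> PD PZ Pg u; elim/uea_ind: u => [x|a|x y hx hy|x y hx hy] v Pv.
- elim/cur_ind: x => [x a|x y hx hy]; first exact: Pg.
  by rewrite linearD scalerDl; exact: PD.
- exact: PZ.
- by rewrite scalerDl; apply: PD; [exact: hx|exact: hy].
- by rewrite -scalerA; apply: hx; exact: hy.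
Qed.

Lemma wsum_uea (u : UgA) v : wsum (h := h) (V := gmod V) (fun=> True) v ->
  wsum (h := h) (V := gmod V) (fun=> True) (u *: v).
Proof.
apply: uea_closed => [v1 v2|a v1|x a v1 hv]; first exact: wsumD.
  by rewrite -gmodZ; exact: wsumZ.
have [e eb er] := root_basis h.
rewrite (coord_basis eb (memvf x)).
have -> : cur (\sum_i coord e i x *: e`_i) a = \sum_i coord e i x *: cur e`_i a.
  rewrite (big_morph (fun y => cur y a) (fun y z => @curDl _ _ A y z a) (@pure0l K K (scalar_bimod g) A a)).
  by apply: eq_bigr => i _; rewrite curZl.
rewrite linear_sum scaler_suml; apply: big_ind => [|v2 v3|i _].
- exact: wsum0.
- exact: wsumD.
rewrite ugenZ_act -gmodZ; apply: wsumZ.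
have [beta bi] := er i; rewrite -tnth_nth.
apply: (@wsum_map _ _ _ (gmod V) (gmod V) (fun=> True) (fun=> True)
  (fun w : V => ugen (cur (tnth e i) a) *: w) _ _ _ _ hv).
- by move=> v2 v3; rewrite scalerDr.
- by rewrite scaler0.
- by move=> mu v2 _ hv2; apply: (wsum1 (mu := mu + beta)) => //; exact: cweight_root.
Qed.

Definition lf_vector (v : V) := exists s : seq (gmod V), in_span s (v : gmod V) /\
  forall (x : g) (w : gmod V), in_span s w -> in_span s (ugen x *: w).

Lemma lf_vectorD v w : lf_vector v -> lf_vector w -> lf_vector (v + w).
Proof.
move=> [s1 [vs1 st1]] [s2 [vs2 st2]].
have sub1 (y : gmod V) : in_span s1 y -> in_span (s1 ++ s2) y.
  by apply: in_span_trans => z ys; apply: mem_in_span; rewrite mem_cat ys.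
have sub2 (y : gmod V) : in_span s2 y -> in_span (s1 ++ s2) y.
  by apply: in_span_trans => z ys; apply: mem_in_span; rewrite mem_cat ys orbT.
exists (s1 ++ s2); split; first by apply: in_spanD; [exact: sub1|exact: sub2].
move=> x; apply: in_span_ugen => y; rewrite mem_cat => /orP[ws|ws].
  by apply/sub1/st1/mem_in_span.
by apply/sub2/st2/mem_in_span.
Qed.

(** If span s is g-stable then so is the sum of span s and of the (y (x) a) span s for
y in g, as x (y (x) a) v = ([x, y] (x) a) v + (y (x) a) x v. *)
Lemma lf_vector_uea (u : UgA) v : lf_vector v -> lf_vector (u *: v).
Proof.
apply: uea_closed => [|a v1 [s [vs st]]|x a v1 [s [vs st]]]; first exact: lf_vectorD.
- by exists s; split=> //; rewrite -gmodZ; exact: in_spanZ.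
pose e := vbasis {:g}.
pose s' := [seq ugen (cur y a) *: w : gmod V | y <- e, w <- s].
have s'P y (w : gmod V) : in_span s w -> in_span s' (ugen (cur y a) *: w : gmod V).
  move=> [c ->]; rewrite scaler_sumr; apply: in_span_sum => i.
  rewrite [X in in_span _ X](_ : _ = (c i)%:A *: (ugen (cur y a) *: s`_i : gmod V)); last first.
    by rewrite !gmodZ uactZ.
  apply: in_spanZ; rewrite (coord_vbasis (memvf y)).
  rewrite (big_morph (fun z => cur z a) (fun y z => @curDl _ _ A y z a)
    (@pure0l K K (scalar_bimod g) A a)) linear_sum scaler_suml.
  apply: in_span_sum => j; rewrite curZl ugenZ_act -gmodZ; apply: in_spanZ.
  apply: mem_in_span; apply/allpairsP; exists (e`_j, s`_i).
  by split=> //; apply: mem_nth; rewrite ?size_tuple.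
exists (s ++ s').
have sub (w : gmod V) : in_span s w -> in_span (s ++ s') w.
  by apply: in_span_trans => y ys; apply: mem_in_span; rewrite mem_cat ys.
have sub' (w : gmod V) : in_span s' w -> in_span (s ++ s') w.
  by apply: in_span_trans => y ys; apply: mem_in_span; rewrite mem_cat ys orbT.
split; first by apply/sub'/s'P.
move=> z; apply: in_span_ugen => w; rewrite mem_cat => /orP[ws|].
  by apply/sub/st/mem_in_span.
move=> /allpairsP[[y w'] /= [_ w's ->]].
rewrite gmod_ugen uact_lie lieb_cur mul1r; apply: in_spanD; apply/sub'/s'P.
  exact: mem_in_span.
by rewrite -gmod_ugen; apply/st/mem_in_span.
Qed.

(** By independence of weights, a module spanned by vectors of weights <= lambda has
no other weights, so its truncation at lambda is the module itself. *)
Lemma in_I_le_crit n (alpha : n.-tuple (hdual h)) (lambda : hdual h) :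
  (forall v, lf_vector v) ->
  (forall v, wsum (h := h) (V := gmod V) (fun nu => wle alpha nu lambda) v) ->
  in_I_le alpha lambda V.
Proof.
move=> lf ws; split; first exact: lf.
move=> v [s hs ->]; rewrite big_seq big1 // => p /hs[mu mul hp].
by rewrite (wsum_weight (V := gmod V) (ws p.2) mul hp) scaler0.
Qed.
End OneModule.

Lemma lf_vector_map (V V' : lmodType UgA) (F : {linear V -> V'}) v :
  lf_vector v -> lf_vector (F v).
Proof.
move=> [s [vs st]]; pose s' : seq (gmod V') := [seq F (w : V) | w <- s].
have FZ (a : uea g) (w : gmod V) : F (a *: w : gmod V) = a *: (F (w : V) : gmod V').
  exact: linear_gmod.
have sub (w : gmod V) : in_span s w -> in_span s' (F (w : V) : gmod V').
  move=> [c ->]; rewrite (_ : F _ = \sum_i (c i)%:A *: (F s`_i : gmod V')).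
    by apply: in_span_sum => i; apply/in_spanZ/mem_in_span/map_f/mem_nth.
  by rewrite linear_sum; apply: eq_bigr => i _; exact: FZ.
exists s'; split; first exact: sub.
move=> x; apply: in_span_ugen => _ /mapP[w ws ->].
by rewrite -FZ; apply/sub/st/mem_in_span.
Qed.
End CurrentModules.

(** * The universal property of the global Weyl module *)

Section WeylModules.
Variables (K : numClosedFieldType) (g : lieVectType K) (h : cartan g) (A : comAlgType K).
Variables (n : nat) (alpha omega : n.-tuple (hdual h)).
Hypotheses (simple_g : lie_simple g) (simple_alpha : simple_roots alpha).
Hypothesis fund_omega : fundamental_weights alpha omega.
Variables (lambda : hdual h) (Vl : hw_irrep alpha lambda).
Local Notation UgA := (uea (current g A)).
Local Notation W := (global_weyl Vl A).
Local Notation w_ := (weyl_gen Vl A).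

Lemma cweight_map (V V' : lmodType UgA) (F : {linear V -> V'}) (mu : hdual h) (v : V) :
  cweight mu v -> cweight mu (F v).
Proof. by move=> hv t; rewrite gmod_ugen gmodZ -!linearZ -gmod_ugen hv gmodZ. Qed.

(** The weight lambda + beta is not <= lambda when beta is a positive root. *)
Lemma in_I_le_highest (V : lmodType UgA) (v : V) : in_I_le alpha lambda V ->
  cweight lambda v -> forall (beta : hdual h) x, is_root beta -> Qplus alpha beta ->
  root_space beta x -> ugen x *: (v : gmod V) = 0.
Proof.
move=> [_ tr] hv beta x rb qb xb; apply: tr.
exists [:: (1 : UgA, (ugen x *: (v : gmod V) : V))]; last by rewrite big_seq1 scale1r.
move=> p; rewrite inE => /eqP -> /=; exists (lambda + beta); last exact: weight_space_root.
rewrite /wle opprD addNKr => qNb.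
by case: rb => /eqP[]; apply: (Qplus_anti simple_alpha qb qNb).
Qed.

Section Universal.
Variables (V : lmodType UgA) (v : V).
Hypotheses (VI : in_I_le alpha lambda V) (hv : cweight lambda v).

(** The map V(lambda) -> V extends to the induced module; as V has only weights
<= lambda, it kills the submodule divided out in the truncation. *)
Theorem weyl_universal : exists F : {linear W -> V}, F w_ = v.
Proof.
have [f fv] : exists f : {linear Vl -> gmod V}, f (hwv Vl) = v.
  apply: (hw_hom simple_g simple_alpha fund_omega Vl VI.1 hv).
  exact: in_I_le_highest.
pose P := tensor (regular_bimod (uincl g A)) Vl.
pose k (m : regular_bimod (uincl g A)) (y : Vl) : V := (m : UgA) *: (f y : V).
have kDl y : {morph k^~ y : m m' / m + m'} by move=> m m'; rewrite /k -scalerDl.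
have kDr m : {morph k m : y y' / y + y'}.
  by move=> y y'; rewrite /k linearD scalerDr.
have kbal m a y : k (ract m a) y = k m (a *: y).
  by rewrite /k linearZ /= -scalerA.
pose F0 : P -> V := tlift k.
have F0D : {morph F0 : y z / y + z} by exact: tliftD.
have F0p m y : F0 (pure m y) = k m y by exact: tlift_pure.
have F0_lin : linear F0.
  move=> a y z; rewrite F0D; congr (_ + _).
  elim/tensor_ind: y => [m y|y y' hy hy']; last by rewrite scalerDr !F0D hy hy' scalerDr.
  by rewrite -pureZl !F0p /k scalerA.
pose F1 : {linear P -> V} := HB.pack F0 (GRing.isLinear.Build _ _ _ _ F0 F0_lin).
have F1_tr y : trunc_mem alpha lambda y -> F1 y = 0.
  move=> [s hs ->]; rewrite linear_sum big_seq big1 // => p /hs[mu mul hp].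
  rewrite linearZ /= [F0 _](_ : _ = 0) ?scaler0 //; apply: VI.2.
  exists [:: (1 : UgA, F1 p.2)]; last by rewrite big_seq1 scale1r.
  move=> q; rewrite inE => /eqP -> /=; exists mu => //; exact: (cweight_map F1 hp).
pose F (z : W) : V := F1 (repr z).
have FE (y : P) : F (qproj _ y) = F1 y.
  apply/eqP; rewrite -subr_eq0 -linearB; apply/eqP/F1_tr.
  have /qprojP : qproj (trunc_sub alpha (induced_module Vl A) lambda)
    (repr (qproj (trunc_sub alpha (induced_module Vl A) lambda) y)) = qproj _ y by exact: qprojK.
  by move/asboolP.
have F_lin : linear F.
  by move=> a y z; rewrite -(qprojK y) -(qprojK z) -linearP !FE linearP.
exists (HB.pack_for {linear W -> V} F (GRing.isLinear.Build _ _ _ _ F F_lin)).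
by rewrite [LHS](FE (@pure _ _ (regular_bimod (uincl g A)) Vl 1 (hwv Vl))) /= F0p /k fv scale1r.
Qed.
End Universal.

Definition weyl_incl (y : Vl) : gmod W :=
  qproj _ (@pure _ _ (regular_bimod (uincl g A)) Vl 1 y).
Lemma weyl_incl_linear : linear weyl_incl.
Proof.
move=> x y z; rewrite /weyl_incl pureDr -pure_bal raddfD; congr (_ + _).
rewrite (_ : @pure _ _ _ _ _ _ = uincl g A x *: @pure _ _ (regular_bimod (uincl g A)) Vl 1 y).
  by rewrite [LHS](linearZ_LR (qproj (trunc_sub alpha (induced_module Vl A) lambda))).
by rewrite -pureZl; congr pure; rewrite /= mul1r; exact: esym (mulr1 _).
Qed.

Lemma weyl_gen_weight : cweight lambda w_.
Proof.
have lin := weyl_incl_linear.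
pose F : {linear Vl -> gmod W} := HB.pack weyl_incl (GRing.isLinear.Build _ _ _ _ weyl_incl lin).
by move=> t; rewrite -[w_]/(F (hwv Vl)) -!linearZ hwv_weight.
Qed.

Lemma weyl_lf (z : W) : lf_vector z.
Proof.
have [u ->] := weyl_cyclic z; apply: lf_vector_uea.
have lin := weyl_incl_linear.
pose F : {linear Vl -> gmod W} := HB.pack weyl_incl (GRing.isLinear.Build _ _ _ _ weyl_incl lin).
have [s s_all] := irrep_fin_dim Vl.
have F_span y : in_span [seq F w | w <- s] (F y).
  have [c ->] := s_all y; rewrite linear_sum; apply: in_span_sum => i.
  by rewrite linearZ; apply/in_spanZ/mem_in_span/map_f/mem_nth.
exists [seq F w | w <- s]; split; first exact: (F_span (hwv Vl)).
move=> x; apply: in_span_ugen => _ /mapP[y ys ->].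
by rewrite -linearZ.
Qed.

Lemma induced_wsum (y : induced_module Vl A) :
  wsum (h := h) (V := gmod (induced_module Vl A)) (fun=> True) y.
Proof.
pose p (w : Vl) : induced_module Vl A := @pure _ _ (regular_bimod (uincl g A)) Vl 1 w.
have pZ x w : p (x *: w) = uincl g A x *: p w.
  by rewrite /p -pure_bal -pureZl; congr pure; rewrite /= mul1r; exact: esym (mulr1 _).
elim/tensor_ind: y => [m w|y z hy hz]; last exact: wsumD.
have [x ->] := irrep_cyclic w.
rewrite -pure_bal [pure _ _](_ : _ = (m * uincl g A x) *: p (hwv Vl)); last first.
  by rewrite /p -pureZl; congr pure; exact: esym (mulr1 _).
apply: wsum_uea; apply: (wsum1 (mu := lambda)) => // t.
rewrite -[LHS]/(uincl g A (ugen (sub_incl t)) *: p (hwv Vl)) -pZ hwv_weight pZ.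
by [].
Qed.

(** Decompose a representative in the induced module: its components of weight not
<= lambda vanish in the truncation. *)
Lemma weyl_wsum (z : W) :
  wsum (h := h) (V := gmod W) (fun nu => wle alpha nu lambda) z.
Proof.
rewrite -(qprojK z).
apply: (@wsum_map _ _ _ (gmod (induced_module Vl A)) (gmod W) (fun=> True) _
  (qproj (trunc_sub alpha (induced_module Vl A) lambda)) _ _ _ _ (induced_wsum (repr z))).
- by move=> x y; exact: linearD.
- exact: linear0.
move=> mu y _ hy; have [mul|mul] := pselect (wle alpha mu lambda).
  by apply: (@wsum1 _ _ _ (gmod W) (fun nu => wle alpha nu lambda) _ _ mul); exact: (cweight_map (qproj _) hy).
rewrite [qproj _ _](_ : _ = 0); first exact: wsum0.
apply/eqP; rewrite -subr_eq0 subr0 -(linear0 (qproj _)); apply/eqP/qprojP; rewrite subr0.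
apply/asboolP; exists [:: (1 : UgA, (y : induced_module Vl A))].
  by move=> q; rewrite inE => /eqP -> /=; exists mu.
by rewrite big_seq1 scale1r.
Qed.

Lemma weyl_in_I : in_I_le alpha lambda W.
Proof. by apply: in_I_le_crit => z; [exact: weyl_lf|exact: weyl_wsum]. Qed.

Lemma Ann_kills_holds : Ann_kills Vl A.
Proof.
move=> V VI v u hv; rewrite inE => /eqP uw.
have [F Fv] := weyl_universal VI hv.
by rewrite -Fv -linearZ uw linear0.
Qed.

Lemma cweight_UhA (V : lmodType UgA) (u : uea (current (sub_lie h) A)) (mu : hdual h) (v : V) :
  cweight mu v -> cweight mu (hincl h A u *: v).
Proof.
move=> hv t; rewrite gmod_ugen gmodZ.
have e : ugen (cur (sub_incl t) (1 : A)) = hincl h A (ugen (cur t 1)).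
  by rewrite uea_map_gen /= current_map_cur.
have c : hincl h A (ugen (cur t 1)) *: (hincl h A u *: v) =
         hincl h A u *: (hincl h A (ugen (cur t 1)) *: v).
  by rewrite !scalerA -!rmorphM UhA_comm.
by rewrite e c -e -gmod_ugen hv gmodZ uactZ.
Qed.

Lemma right_action_wd_holds : right_action_wd Vl A.
Proof.
move=> u x uw; have [F Fw] := weyl_universal weyl_in_I (cweight_UhA x weyl_gen_weight).
by rewrite -scalerA -Fw -linearZ uw linear0.
Qed.

(** For each m, z |-> z (x) m is a map from W_A(lambda), and the images of these maps
span. *)
Lemma weyl_lands_holds (wd : right_action_wd Vl A) : weyl_lands wd.
Proof.
move=> M.
pose i m (z : W) := weyl_pure wd z m : weyl_obj wd M.
have i_lin m : linear (i m) by move=> a z z'; rewrite /i /weyl_pure pureDl pureZl.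
pose I m : {linear W -> weyl_obj wd M} :=
  HB.pack (i m) (GRing.isLinear.Build _ _ _ _ (i m) (i_lin m)).
apply: in_I_le_crit; elim/tensor_ind => [z m|x y hx hy].
- exact: (lf_vector_map (I m) (weyl_lf z)).
- exact: lf_vectorD.
- apply: (@wsum_map _ _ _ (gmod W) (gmod (weyl_obj wd M)) (fun nu => wle alpha nu lambda) _
    (I m) _ _ _ _ (weyl_wsum z)).
  + by move=> x y; exact: linearD.
  + exact: linear0.
  + by move=> mu v mul hv; apply: (@wsum1 _ _ _ (gmod _) (fun nu => wle alpha nu lambda) _ _ mul); exact: (cweight_map (I m) hv).
- exact: wsumD.
Qed.
End WeylModules.

(** * The counit and the adjunction *)

Section Adjunction.
Variables (K : numClosedFieldType) (g : lieVectType K) (h : cartan g) (A : comAlgType K).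
Variables (n : nat) (alpha omega : n.-tuple (hdual h)).
Hypotheses (simple_g : lie_simple g) (simple_alpha : simple_roots alpha).
Hypothesis fund_omega : fundamental_weights alpha omega.
Variables (lambda : hdual h) (Vl : hw_irrep alpha lambda).
Local Notation UgA := (uea (current g A)).
Local Notation W := (global_weyl Vl A).
Local Notation w_ := (weyl_gen Vl A).
Variables (wd : right_action_wd Vl A) (kill : Ann_kills Vl A) (lands : weyl_lands wd).
Local Notation Al := (Alambda Vl A).

Section Counit.
Variable V : I_obj alpha A lambda.
Local Notation Vwt := (wt_mod V kill).

Lemma wt_valZ (u : uea (current (sub_lie h) A)) (v : Vwt) :
  wt_val (rproj (Annh Vl A) u *: v : Vwt) = hincl h A u *: wt_val v.
Proof. exact: wt_scaleE. Qed.

(** The value is u v for any u with z = u w_lambda; [evE] is the independence of u. *)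
Definition ev (z : weyl_bimod wd) (v : Vwt) : V :=
  projT1 (cid (weyl_cyclic z)) *: wt_val v.
Lemma evE u (v : Vwt) : ev (u *: w_) v = u *: wt_val v.
Proof.
rewrite /ev; case: cid => u' /= uu'.
have [F Fw] := weyl_universal simple_g simple_alpha fund_omega Vl (I_modP V)
  (asboolW (wt_valP v)).
by have := congr1 F uu'; rewrite !linearZ Fw.
Qed.
Lemma evDl v : {morph ev^~ v : z z' / z + z'}.
Proof.
move=> z z'; have [u ->] := weyl_cyclic z; have [u' ->] := weyl_cyclic z'.
by rewrite -scalerDl !evE scalerDl.
Qed.
Lemma evDr z : {morph ev z : v v' / v + v'}.
Proof. by move=> v v'; rewrite /ev wt_valD scalerDr. Qed.
Lemma ev_bal z (a : Al) v : ev (ract z a) v = ev z (a *: v).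
Proof.
have [u ->] := weyl_cyclic z; rewrite -(rprojK a) [ract _ _]weyl_ractE !evE.
by rewrite wt_valZ scalerA.
Qed.
Definition counit_fun : weyl_obj wd Vwt -> V := tlift ev.
Lemma counit_pure z v : counit_fun (weyl_pure wd z v) = ev z v.
Proof. exact: (tlift_pure evDl evDr ev_bal). Qed.
Lemma counit_linear : linear counit_fun.
Proof.
move=> a x y; rewrite [counit_fun _](tliftD evDl evDr ev_bal); congr (_ + _).
elim/tensor_ind: x => [z v|x x' hx hx'].
  rewrite -pureZl -/counit_fun [LHS]counit_pure [counit_fun _]counit_pure.
  by have [u ->] := weyl_cyclic z; rewrite scalerA !evE scalerA.
rewrite scalerDr; have D := tliftD evDl evDr ev_bal.
by rewrite [LHS]D [counit_fun _]D hx hx' scalerDr.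
Qed.
HB.instance Definition _ :=
  GRing.isLinear.Build UgA (weyl_obj wd Vwt) V *:%R counit_fun counit_linear.
Definition counit : {linear weyl_obj wd Vwt -> V} := counit_fun.
Lemma counitE u v : counit (weyl_pure wd (u *: w_) v) = u *: wt_val v.
Proof. by rewrite /counit /= counit_pure evE. Qed.
End Counit.

Let WA := weyl_functor lands.
Let RA := weight_functor kill.

Lemma weyl_obj_ext (M : lmodType Al) (V : lmodType UgA)
  (f f' : {linear weyl_obj wd M -> V}) :
  (forall u m, f (weyl_pure wd (u *: w_) m) = f' (weyl_pure wd (u *: w_) m)) -> f = f'.
Proof.
move=> ff'; apply: linear_ext; elim/tensor_ind => [z m|x y hx hy].
  by have [u ->] := weyl_cyclic z; exact: ff'.
by rewrite !linearD hx hy.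
Qed.

Lemma counit_natural (V V' : I_category alpha A lambda) (f : Defs.hom V V') :
  compm (counit V' : Defs.hom (functor_comp WA RA V') V') (fmor (functor_comp WA RA) f) =
  compm f (counit V : Defs.hom (functor_comp WA RA V) V).
Proof.
apply: (@weyl_obj_ext _ (I_mod V')) => u v /=.
rewrite [tensor_map _ _]tensor_map_pure.
rewrite [LHS](counitE u (wt_map f v)) [counit_fun _](counitE u v).
by rewrite linearZ.
Qed.

Definition counit_trans : nat_trans (functor_comp WA RA) (functor_id (I_category alpha A lambda)) :=
  @NatTrans _ _ (functor_comp WA RA) (functor_id _) counit counit_natural.

Section Transpose.
Variables (X : lmodType Al) (Y : I_obj alpha A lambda).
Variable k : {linear weyl_obj wd X -> Y}.
(** z |-> k (z (x) m) is a module map, so it preserves the weight of w_lambda. *)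
Lemma transpose_wt (m : X) : k (weyl_pure wd w_ m) \in @wt_pred _ _ _ _ _ _ _ Y.
Proof.
have lin : linear (fun z : W => weyl_pure wd z m : weyl_obj wd X).
  by move=> a z z'; rewrite /weyl_pure pureDl pureZl.
pose I : {linear W -> weyl_obj wd X} :=
  HB.pack (fun z : W => weyl_pure wd z m : weyl_obj wd X)
    (GRing.isLinear.Build _ _ _ _ (fun z : W => weyl_pure wd z m : weyl_obj wd X) lin).
apply/asboolP/(cweight_map k); exact: (cweight_map I (weyl_gen_weight A Vl)).
Qed.
Definition transpose_fun (m : X) : wt_mod Y kill := WtMod kill (transpose_wt m).
Lemma transpose_linear : linear transpose_fun.
Proof.
move=> a m m'; apply: wt_val_inj; rewrite wt_valD -(rprojK a) wt_valZ /=.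
rewrite /weyl_pure pureDr linearD -linearZ -pureZl; congr (k _ + _).
rewrite -pure_bal; congr pure.
have := weyl_ractE wd 1 (repr a); rewrite scale1r mul1r; exact.
Qed.
HB.instance Definition _ :=
  GRing.isLinear.Build Al X (wt_mod Y kill) *:%R transpose_fun transpose_linear.
Definition transpose : {linear X -> wt_mod Y kill} := transpose_fun.
End Transpose.

Definition untranspose (X : lmodType Al) (Y : I_obj alpha A lambda)
  (f : {linear X -> wt_mod Y kill}) : {linear weyl_obj wd X -> Y} :=
  counit Y \o @tensor_map _ _ (weyl_bimod wd) X (wt_mod Y kill) f.

Lemma untransposeE (X : lmodType Al) (Y : I_obj alpha A lambda)
  (f : {linear X -> wt_mod Y kill}) u m :
  untranspose f (weyl_pure wd (u *: w_) m) = u *: wt_val (f m).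
Proof. by rewrite /= [tensor_map _ _]tensor_map_pure counit_pure evE. Qed.

Lemma transposeK (X : lmodType Al) (Y : I_obj alpha A lambda) :
  cancel (@transpose X Y) (@untranspose X Y).
Proof.
move=> k; apply: weyl_obj_ext => u m; rewrite untransposeE /=.
by rewrite -linearZ -pureZl.
Qed.
Lemma untransposeK (X : lmodType Al) (Y : I_obj alpha A lambda) :
  cancel (@untranspose X Y) (@transpose X Y).
Proof.
move=> f; apply: linear_ext => m; apply: wt_val_inj.
by rewrite -[RHS]scale1r -(untransposeE f 1) scale1r.
Qed.

Theorem weyl_weight_adjoint : right_adjoint RA WA.
Proof.
exists (fun X Y k => transpose k); split=> [X Y|X X' Y f k|X Y Y' f k].
- exists (@untranspose X Y); [exact: transposeK|exact: untransposeK].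
- apply: linear_ext => m; apply: wt_val_inj => /=.
  by rewrite [tensor_map _ _]tensor_map_pure.
- by apply: linear_ext => m; apply: wt_val_inj.
Qed.
End Adjunction.

Theorem proposition3p6
  (R : realType) (g : lieVectType R[i]) (simple_g : lie_simple g)
  (h : cartan g) (n : nat)
  (alpha : n.-tuple (hdual h)) (simple_alpha : simple_roots alpha)
  (omega : n.-tuple (hdual h)) (fund_omega : fundamental_weights alpha omega)
  (A : comAlgType R[i])
  (lambda : hdual h) (dominant_lambda : Pplus omega lambda)
  (Vl : hw_irrep alpha lambda) :
  exists (wd : right_action_wd Vl A) (kill : Ann_kills Vl A)
         (lands : weyl_lands wd),
    let WA := weyl_functor lands in
    let RA := weight_functor kill in
    (exists eta : nat_trans (functor_comp WA RA) (functor_id (I_category alpha A lambda)),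
       forall (V : I_obj alpha A lambda) (u : uea (current g A)) (v : wt_mod V kill),
         (eta V : {linear weyl_obj wd (wt_mod V kill) -> V})
           (weyl_pure wd (u *: weyl_gen Vl A) v) = u *: wt_val v)
    /\ right_adjoint RA WA.
Proof.
have wd : right_action_wd Vl A.
  exact: (right_action_wd_holds simple_g simple_alpha fund_omega).
have kill : Ann_kills Vl A.
  exact: (Ann_kills_holds simple_g simple_alpha fund_omega).
have lands : weyl_lands wd by exact: weyl_lands_holds.
exists wd, kill, lands; split; last first.
  exact: (weyl_weight_adjoint simple_g simple_alpha fund_omega).
exists (counit_trans simple_g simple_alpha fund_omega kill lands) => V u v.
exact: (counitE simple_g simple_alpha fund_omega).
Qed.
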